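(* Let $q$ be a prime power with $q\equiv 1\pmod 3$. Let $\mathcal{Q}^+(7,q)$ be the hyperbolic quadric of the trace-zero hyperplane $\Pi$ of $\mathrm{PG}(8,q)$, let $\Gamma$ be the thin hexagon in $\Pi$ and let $\pi_x$ be the plane spanned by the two lines of $\Gamma$ through a point $x$ of $\Gamma$ (all as defined in the context). Then the set of points $$\mathcal{O}=\bigcup_{x\in\Gamma}\pi_x ,$$ where $x$ ranges over all points of $\Gamma$, is a $(q^2+q+1)$-ovoid of $\mathcal{Q}^+(7,q)$.
   Context: Let $q\equiv 1\pmod 3$ be a prime power and let $\mathrm{PG}(8,q)$ have homogeneous coordinates $X_1,\dots,X_9$ over the finite field $\mathbb{F}_q$. Identify a $3\times 3$ matrix $M=(m_{ij})$ over $\mathbb{F}_q$ with the vector $\rho(M)=(m_{11},m_{12},m_{13},m_{21},m_{22},m_{23},m_{31},m_{32},m_{33})\in\mathbb{F}_q^9$. Segre variety: $\mathcal{S}_{2,2}$ is the set of $(q^2+q+1)^2$ points of $\mathrm{PG}(8,q)$ represented by $(a_1b_1,a_1b_2,a_1b_3,a_2b_1,a_2b_2,a_2b_3,a_3b_1,a_3b_2,a_3b_3)$ with $a_i,b_i\in\mathbb{F}_q$, $(a_1,a_2,a_3)\neq(0,0,0)$ and $(b_1,b_2,b_3)\ne(0,0,0)$, i.e. the points corresponding to rank-one matrices. Quadrics: $\mathcal{Q}(8,q)$ is the parabolic quadric $X_2X_4-X_1X_5+X_3X_7-X_1X_9+X_6X_8-X_5X_9=0$; it contains $\mathcal{S}_{2,2}$.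 $\Pi$ is the hyperplane $X_1+X_5+X_9=0$ (trace-zero matrices), a copy of $\mathrm{PG}(7,q)$. Since $q\equiv1\pmod3$, $\Pi\cap\mathcal{Q}(8,q)$ is a hyperbolic quadric, denoted $\mathcal{Q}^+(7,q)$. Hexagon: $\Gamma$ is the point-line geometry whose points are the $(q+1)(q^2+q+1)$ points of $\Pi\cap\mathcal{S}_{2,2}$ and whose lines are the $2(q^2+q+1)$ projective lines contained in $\Pi\cap\mathcal{S}_{2,2}$; it is a thin generalized hexagon (of order $(q,1)$), isomorphic to the point-line flag geometry of $\mathrm{PG}(2,q)$. Through each point $x$ of $\Gamma$ there pass exactly two lines of $\Gamma$; they span a plane, denoted $\pi_x$, which is contained in $\mathcal{Q}^+(7,q)$. Definition of $m$-ovoid: let $\mathcal{P}$ be the point set of a hyperbolic quadric $\mathcal{Q}^+(2r-1,q)$. A subset $\mathcal{M}\subseteq\mathcal{P}$ is an $m$-ovoid ($m>0$ an integer) if for every $P\in\mathcal{P}$, $$|P^\perp\cap\mathcal{M}|=\begin{cases} m\theta_{r-1}-\theta_{r-1}+1, & P\in\mathcal{M},\\ m\theta_{r-1}, & P\notin\mathcal{M},\end{cases}$$ where $\theta_r=q^{r-1}+1$ (so $\theta_{r-1}=q^{r-2}+1$) and $P^\perp$ is the set of points of $\mathcal{Q}^+(2r-1,q)$ collinear with $P$ (including $P$ itself), i.e. the points of the quadric lying in the polar hyperplane of $P$. Here $r=4$. *)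

(* Defs.v *)
From HB Require Import structures.
From mathcomp Require Import all_boot all_order all_algebra all_fingroup.
From mathcomp Require Import all_solvable all_field.
From mathcomp Require Import ring.

Set Implicit Arguments.
Unset Strict Implicit.
Unset Printing Implicit Defensive.

Import GRing.Theory.
Local Open Scope ring_scope.

Section ProjectiveSpace.
Variables (F : finFieldType) (n : nat).

(* A subspace of F^n is represented by the matrix <<U>>, canonical for its row
   space, so that equality of subspaces is Leibniz equality in the finite type
   'M[F]_n.  A subspace of rank d is a projective subspace of dimension d - 1
   of PG(n-1, q); incidence is the row space inclusion (_ <= _)%MS. *)
Definition subspaces (d : nat) : {set 'M[F]_n} :=
  [set U : 'M[F]_n | (<<U>>%MS == U) && (\rank U == d)].

Definition pg_points : {set 'M[F]_n} := subspaces 1.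
Definition pg_lines : {set 'M[F]_n} := subspaces 2.

Definition points_on (U : 'M[F]_n) : {set 'M[F]_n} :=
  [set P in pg_points | (P <= U)%MS].

Definition polar_form (Q : 'rV[F]_n -> F) (u v : 'rV[F]_n) : F :=
  Q (u + v) - Q u - Q v.

(* Q^+(2r-1, q) in the projective space of V: in suitable coordinates
   (a, b) on V, the form Q is a_1 b_1 + ... + a_r b_r. *)
Definition is_hyperbolic (r : nat) (V : 'M[F]_n) (Q : 'rV[F]_n -> F) : Prop :=
  \rank V = r.*2 /\
  exists e f : 'M[F]_(r, n), (V :=: e + f)%MS /\
    forall a b : 'rV[F]_r,
      Q (a *m e + b *m f) = \sum_(i < r) a 0 i * b 0 i.

Record hyperbolic_quadric (r : nat) := HyperbolicQuadric {
  hq_space : 'M[F]_n;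
  hq_form : 'rV[F]_n -> F;
  hq_hyperbolic : is_hyperbolic r hq_space hq_form
}.

Section Ovoid.
Variables (r : nat) (H : hyperbolic_quadric r).

Definition hq_points : {set 'M[F]_n} :=
  [set P in points_on (hq_space H) |
     [forall v : 'rV[F]_n, (v <= P)%MS ==> (hq_form H v == 0)]].

Definition hq_perp (P : 'M[F]_n) : {set 'M[F]_n} :=
  [set R in hq_points |
     [forall u : 'rV[F]_n, forall v : 'rV[F]_n,
        ((u <= P)%MS && (v <= R)%MS) ==> (polar_form (hq_form H) u v == 0)]].

End Ovoid.
End ProjectiveSpace.

Definition theta (q r : nat) : nat := (q ^ r.-1 + 1)%N.

Definition m_ovoid (F : finFieldType) (n r : nat)
    (H : hyperbolic_quadric F n r) (m : nat) (M : {set 'M[F]_n}) : Prop :=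
  let t := theta #|F| r.-1 in
  [/\ (0 < m)%N,
      M \subset hq_points H &
      forall P, P \in hq_points H ->
        #|hq_perp H P :&: M|
        = (if P \in M then m * t - t + 1 else m * t)%N].

Section Hexagon.
Variable F : finFieldType.

(* Homogeneous coordinates are numbered from 1. *)
Definition X (k : nat) (v : 'rV[F]_9) : F := v 0 (inord k.-1).

Definition rho (M : 'M[F]_3) : 'rV[F]_9 :=
  \row_(k < 9) M (inord (k %/ 3)) (inord (k %% 3)).

Definition rank_one (a b : 'rV[F]_3) : 'M[F]_3 :=
  \matrix_(i < 3, j < 3) (a 0 i * b 0 j).

Definition segre : {set 'M[F]_9} :=
  [set <<rho (rank_one a b)>>%MS | a in [set~ 0], b in [set~ 0]].

Definition Q8 (v : 'rV[F]_9) : F :=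
  X 2 v * X 4 v - X 1 v * X 5 v + X 3 v * X 7 v - X 1 v * X 9 v
  + X 6 v * X 8 v - X 5 v * X 9 v.

(* The hyperplane X_1 + X_5 + X_9 = 0, see sub_Pi below. *)
Definition Pi : 'M[F]_9 :=
  kermx (\col_(k < 9) ((nat_of_ord k) \in [:: 0; 4; 8])%N%:R).

Definition hexagon_points : {set 'M[F]_9} := points_on Pi :&: segre.

Definition hexagon_lines : {set 'M[F]_9} :=
  [set L in pg_lines F 9 | points_on L \subset hexagon_points].

Definition hexagon_plane (x : 'M[F]_9) : 'M[F]_9 :=
  (\sum_(L in hexagon_lines | (x <= L)%MS) L)%MS.

Lemma XE k (v : 'rV[F]_9) (i : 'I_9) : nat_of_ord i = k.-1 -> X k v = v 0 i.
Proof. by rewrite /X => <-; rewrite inord_val. Qed.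

Lemma sub_Pi (v : 'rV[F]_9) :
  (v <= Pi)%MS = (X 1 v + X 5 v + X 9 v == 0).
Proof.
have E : v *m (\col_(k < 9) ((nat_of_ord k) \in [:: 0; 4; 8])%N%:R)
         = (X 1 v + X 5 v + X 9 v)%:M.
  apply/rowP=> j; rewrite !ord1 !mxE !big_ord_recl big_ord0 !mxE /=.
  rewrite (@XE 1 v ord0) // (@XE 5 v (lift ord0 (lift ord0 (lift ord0
    (lift ord0 ord0))))) // (@XE 9 v ord_max) //.
  rewrite (_ : lift ord0 (lift ord0 (lift ord0 (lift ord0 (lift ord0
    (lift ord0 (lift ord0 (lift ord0 ord0))))))) = ord_max); last exact/val_inj.
  by rewrite !mulr1 !mulr0 !add0r !addr0 addrA.
apply/sub_kermxP/eqP; rewrite E; last by move=> ->; rewrite raddf0.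
by move/rowP/(_ 0); rewrite !mxE.
Qed.

Lemma rank_Pi : \rank Pi = 8.
Proof.
rewrite mxrank_ker; set c := \col_(k < 9) _.
have cN0 : c != 0.
  apply/eqP=> /colP/(_ ord0); rewrite !mxE /= => /eqP.
  by rewrite oner_eq0.
have : (0 < \rank c)%N by rewrite lt0n mxrank_eq0.
by have := rank_leq_col c; case: (\rank c) => [|[]].
Qed.

Lemma cube_root1 :
  #|F| = 1 %[mod 3] -> exists2 w : F, w != 1 & w ^+ 2 + w + 1 = 0.
Proof.
move=> h3; have d3 : (3 %| #|[set: {unit F}]|)%N.
  rewrite card_finField_unit -subn1.
  by rewrite -eqn_mod_dvd ?h3 // (cardD1 0) inE.
have [u _ ou] := Cauchy (isT : prime 3) d3.
have u3 : (val u : F) ^+ 3 = 1.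
  by rewrite -FinRing.val_unitX -ou expg_order.
have uN1 : (val u : F) != 1.
  apply/eqP=> u1; have E : u = 1%g by apply/val_inj.
  by move: ou; rewrite E order1.
move: (val u : F) u3 uN1 => {u ou} w w3 wN1; exists w => //.
have w1N0 : w - 1 != 0 by rewrite subr_eq0.
apply: (mulfI w1N0); rewrite mulr0.
by rewrite (_ : _ * _ = w ^+ 3 - 1); [rewrite w3 subrr | ring].
Qed.

Definition rows9 (s : seq (seq F)) : 'M[F]_(4, 9) :=
  \matrix_(i < 4, k < 9) (nth [::] s i)`_k.

(* On Pi the form Q8 is X2 X4 + X3 X7 + X6 X8 + (X1 - w X5) (X1 - w^2 X5),
   where w is a primitive cube root of unity. *)
Lemma Pi_Q8_hyperbolic : #|F| = 1 %[mod 3] -> is_hyperbolic 4 Pi Q8.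
Proof.
move=> /cube_root1 [w w1 w0]; split; first exact: rank_Pi.
have [d dE] : exists d, d * (w ^+ 2 - w) = 1.
  exists (w ^+ 2 - w)^-1; apply: mulVf.
  rewrite (_ : _ - _ = w * (w - 1)); last by ring.
  rewrite mulf_eq0 subr_eq0 negb_or w1 andbT; apply/eqP=> h.
  by move/eqP: w0; rewrite h expr0n /= !add0r oner_eq0.
pose e := rows9 [:: [:: 0; 1]; [:: 0; 0; 1]; [:: 0; 0; 0; 0; 0; 1];
  [:: w ^+ 2 * d; 0; 0; 0; d; 0; 0; 0; w * d]].
pose f := rows9 [:: [:: 0; 0; 0; 1]; [:: 0; 0; 0; 0; 0; 0; 1];
  [:: 0; 0; 0; 0; 0; 0; 0; 1];
  [:: - (w * d); 0; 0; 0; - d; 0; 0; 0; - (w ^+ 2 * d)]].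
have L0 : ord0 = inord 0 :> 'I_4 by apply/val_inj; rewrite /= inordK.
have L1 : lift ord0 ord0 = inord 1 :> 'I_4.
  by apply/val_inj; rewrite /= inordK.
have L2 : lift ord0 (lift ord0 ord0) = inord 2 :> 'I_4.
  by apply/val_inj; rewrite /= inordK.
have L3 : lift ord0 (lift ord0 (lift ord0 ord0)) = inord 3 :> 'I_4.
  by apply/val_inj; rewrite /= inordK.
have coord (a b : 'rV[F]_4) :
  a *m e + b *m f = \row_(k < 9) [:: a 0 (inord 3) * (w ^+ 2 * d) - b 0 (inord 3) * (w * d);
    a 0 (inord 0); a 0 (inord 1); b 0 (inord 0);
    a 0 (inord 3) * d - b 0 (inord 3) * d; a 0 (inord 2);
    b 0 (inord 1); b 0 (inord 2);
    a 0 (inord 3) * (w * d) - b 0 (inord 3) * (w ^+ 2 * d)]`_k.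
  apply/rowP=> k; rewrite !mxE !big_ord_recl !big_ord0 L3 L2 L1 L0 !mxE /=.
  rewrite !inordK //=; move: (a 0 _) (a 0 _) (a 0 _) (a 0 _) => a3 a0 a1 a2.
  move: (b 0 _) (b 0 _) (b 0 _) (b 0 _) => b3 b0 b1 b2.
  by case: k => [[|[|[|[|[|[|[|[|[|k]]]]]]]]] hk] //=; ring.
have QE a b : Q8 (a *m e + b *m f) = \sum_(i < 4) a 0 i * b 0 i.
  rewrite coord /Q8 /X !mxE !inordK //= !big_ord_recl big_ord0 L3 L2 L1 L0.
  move: (a 0 _) (a 0 _) (a 0 _) (a 0 _) => a3 a0 a1 a2.
  move: (b 0 _) (b 0 _) (b 0 _) (b 0 _) => b3 b0 b1 b2.
  pose c := d ^+ 2 * w * (2 * (a1 * b1) - a1 ^+ 2 - b1 ^+ 2).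
  transitivity (a2 * b2 + a0 * b0 + a3 * b3
    + a1 * b1 * (d * (w ^+ 2 - w)) ^+ 2 + c * (w ^+ 2 + w + 1)).
    by rewrite /c; ring.
  by rewrite w0 dE; ring.
exists e, f; split; last exact: QE.
apply/eqmxP/andP; split; apply/rV_subP=> v.
- rewrite sub_Pi /X /= => /eqP v0.
  pose a := \row_(i < 4) [:: v 0 (inord 1); v 0 (inord 2); v 0 (inord 5);
    v 0 (inord 0) - w * v 0 (inord 4)]`_i.
  pose b := \row_(i < 4) [:: v 0 (inord 3); v 0 (inord 6); v 0 (inord 7);
    v 0 (inord 0) - w ^+ 2 * v 0 (inord 4)]`_i.
  have -> : v = a *m e + b *m f.
    rewrite coord; apply/rowP=> k; rewrite -[in LHS](inord_val k) !mxE !inordK //=.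
    have v8 : v 0 (inord 8) = - (v 0 (inord 0) + v 0 (inord 4)).
      by apply/eqP; rewrite -addr_eq0 addrC v0.
    case: k => [[|[|[|[|[|[|[|[|[|k]]]]]]]]] hk] //=.
    + transitivity (v 0 (inord 0) * (d * (w ^+ 2 - w))); last by ring.
      by rewrite dE mulr1.
    + transitivity (v 0 (inord 4) * (d * (w ^+ 2 - w))); last by ring.
      by rewrite dE mulr1.
    + rewrite v8.
      transitivity (- (v 0 (inord 0) + v 0 (inord 4)) * (d * (w ^+ 2 - w))
        + d * w * (w - 1) * v 0 (inord 4) * (w ^+ 2 + w + 1)).
        by rewrite dE w0; ring.
      by ring.
  by rewrite addmx_sub_adds ?submxMl.
- move=> /sub_addsmxP[[a b] ->] /=.
  rewrite sub_Pi coord /X !mxE !inordK //=; apply/eqP.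
  transitivity (d * (a 0 (inord 3) - b 0 (inord 3)) * (w ^+ 2 + w + 1)).
    by ring.
  by rewrite w0 mulr0.
Qed.

End Hexagon.

Definition Qplus7 (F : finFieldType) (hF : #|F| = 1 %[mod 3]) :
    hyperbolic_quadric F 9 4 :=
  HyperbolicQuadric (Pi_Q8_hyperbolic hF).

(* Main.v *)
Require Import Defs.
From mathcomp Require Import all_boot all_algebra.
From mathcomp Require Import mxabelem ring zify.

(* A point x of the hexagon is a rank-one matrix a^T b with a.b = 0, that is a
   flag (point a, line b) of PG(2, q), and pi_x is the set of the matrices
   a^T c + d^T b with c.a = d.b = 0, i.e. of the matrices that are strictly
   triangular with respect to the flag.  So O is the set of the nilpotent
   matrices, and as the polar form of the quadric is tr(MN), the theorem counts
   the nilpotent N with tr(PN) = 0, for a matrix P with tr P = tr P^2 = 0.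

   Count the pairs (flag, N in its plane) with N in the hyperplane P^perp.  A
   nilpotent N lies in 1 plane if its rank is 2, and in 2q+1 planes if its rank
   is 1.  A plane lies in P^perp exactly when its flag is P-invariant.  So one
   needs the number A of P-invariant flags and the number of rank-one nilpotents
   in P^perp, which depends only on the number e of eigenpoints of P.  Since
   P^3 = t I, either P is nilpotent, and A = 2e - 1, or P has 0 or 3 distinct
   eigenvalues, because q = 1 mod 3, and A = 2e. *)

Set Implicit Arguments.
Unset Strict Implicit.
Unset Printing Implicit Defensive.

(** * Counting over finite types and finite row spaces *)

Section FiniteCounting.

Lemma card_fibres (aT rT : finType) (A : {set aT}) (f : aT -> rT) (k : nat) :
  {in A, forall x, #|[set y in A | f y == f x]| = k} ->
  #|A| = (k * #|f @: A|)%N.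
Proof.
move=> fibre; rewrite -sum1_card (partition_big_imset f) /= mulnC -sum_nat_const.
apply: eq_bigr => _ /imsetP[x Ax ->].
by rewrite sum1_card -(fibre x Ax); apply: eq_card => y; rewrite !inE.
Qed.

Lemma card_pairs (aT rT : finType) (A : pred aT) (R : aT -> pred rT) :
  #|[set x : aT * rT | A x.1 && R x.1 x.2]| = \sum_(a | A a) #|[set b | R a b]|.
Proof.
rewrite -sum1_card (eq_bigl (fun x : aT * rT => A x.1 && R x.1 x.2)); last first.
  by move=> x; rewrite inE.
rewrite -(pair_big_dep A R (fun _ _ => 1%N)) /=.
by apply: eq_bigr => a _; rewrite sum1_card cardsE.
Qed.

(** The elements of [A] that satisfy [B] are moved to the other side with weight [n], so that no
    truncated subtraction occurs. The later counts keep this additive form. *)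
Lemma sum_if_const (T : finType) (A B : pred T) (m n : nat) :
  \sum_(i | A i) (if B i then m else n) + #|[set i | A i && B i]| * n
  = #|[set i | A i && B i]| * m + #|[set i | A i]| * n.
Proof.
rewrite (bigID B) /= (eq_bigr (fun=> m)); last by move=> i /andP[_ ->].
rewrite [X in _ + X + _](eq_bigr (fun=> n)); last by move=> i /andP[_ /negPf ->].
rewrite !sum_nat_cond_const -addnA -mulnDl; congr (_ + _ * _).
rewrite -(cardsID [set i | B i] [set i | A i]) addnC.
by congr (_ + _); apply: eq_card => i; rewrite !inE // andbC.
Qed.

(** Both sides count the pairs in [R] with first member in [A]. [B] need only contain every second
    member, so the right-hand sum can run over a set chosen in advance. *)
Lemma double_count (aT rT : finType) (A : pred aT) (R : aT -> pred rT)
    (B : pred rT) : (forall a b, A a -> R a b -> B b) ->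
  \sum_(a | A a) #|[set b | R a b]| = \sum_(b | B b) #|[set a | A a && R a b]|.
Proof.
move=> AB; transitivity (\sum_(a | A a) \sum_(b | R a b) 1).
  by apply: eq_bigr => a _; rewrite sum1_card cardsE.
rewrite (exchange_big_dep B) //=.
by apply: eq_bigr => b _; rewrite sum1_card cardsE.
Qed.

End FiniteCounting.

(** * Kernels, orthogonality and rank-one factorisations over a finite field *)

Section RowSpaces.
Import GRing.Theory.
Local Open Scope ring_scope.
Variable F : finFieldType.

Lemma card_left_ker m n (A : 'M[F]_(n, m)) :
  #|[set v : 'rV_n | v *m A == 0]| = (#|F| ^ (n - \rank A))%N.
Proof.
rewrite -mxrank_ker -card_rowg; apply: eq_card => v; rewrite inE mem_rowg.
by apply/eqP/sub_kermxP.
Qed.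

Lemma card_left_ker_neq0 m n (A : 'M[F]_(n, m)) :
  #|[set v : 'rV_n | (v != 0) && (v *m A == 0)]| = (#|F| ^ (n - \rank A)).-1.
Proof.
rewrite -card_left_ker (cardsD1 0 [set v | _ == 0]) inE mul0mx eqxx /=.
by apply: eq_card => v; rewrite !inE.
Qed.

Lemma card_neq0_rV n : #|[set v : 'rV[F]_n | v != 0]| = (#|F| ^ n).-1.
Proof.
have := card_left_ker_neq0 (0 : 'M_(n, 1)); rewrite mxrank0 subn0 => <-.
by apply: eq_card => v; rewrite !inE mulmx0 eqxx andbT.
Qed.

Lemma card_sub_neq0 m n (U : 'M[F]_(m, n)) :
  #|[set v : 'rV_n | (v != 0) && (v <= U)%MS]| = (#|F| ^ \rank U).-1.
Proof.
rewrite -card_rowg (cardsD1 0 (rowg U)) mem_rowg sub0mx /=.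
by apply: eq_card => v; rewrite in_setD1 mem_rowg inE.
Qed.

Lemma card_line n (a : 'rV[F]_n) :
  a != 0 -> #|[set v : 'rV_n | (v != 0) && (v <= a)%MS]| = #|F|.-1.
Proof. by move=> a0; rewrite card_sub_neq0 rank_rV a0. Qed.

Lemma mxrank_add_row m n (A : 'M[F]_(m, n)) (v : 'rV_n) :
  \rank (A + v)%MS = (\rank A + ~~ (v <= A)%MS)%N.
Proof.
case: (boolP (v <= A)%MS) => vA.
  by rewrite addn0; apply: eqmx_rank; apply/eqmxP/addsmx_idPl.
have v0 : v != 0 by apply: contraNneq vA => ->; rewrite sub0mx.
(* A nonzero intersection of [A] with the line spanned by [v] would be that whole line. *)
rewrite mxrank_disjoint_sum ?rank_rV ?v0 //; apply/eqP.
rewrite -mxrank_eq0; apply: contraNT vA => r0.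
apply: submx_trans (capmxSl A v); rewrite -(geq_leqif (mxrank_leqif_sup (capmxSr A v))).
by rewrite rank_rV v0 lt0n.
Qed.

Lemma mul_tr_eq0C m n p (A : 'M[F]_(m, n)) (B : 'M_(p, n)) :
  (A *m B^T == 0) = (B *m A^T == 0).
Proof. by rewrite -trmx_eq0 trmx_mul trmxK. Qed.

Lemma mx11_eq0 (A : 'M[F]_1) : (A == 0) = (A 0 0 == 0).
Proof.
apply/eqP/eqP => [->|A0]; first by rewrite mxE.
by rewrite [A]mx11_scalar A0 raddf0.
Qed.

Lemma card_orth2 n (a x : 'rV[F]_n) : a != 0 ->
  #|[set b : 'rV_n | [&& b != 0, b *m a^T == 0 & b *m x^T == 0]]|
  = (#|F| ^ (n - (~~ (x <= a)%MS).+1)).-1.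
Proof.
move=> a0; have := card_left_ker_neq0 (col_mx a x)^T.
rewrite mxrank_tr -addsmxE mxrank_add_row rank_rV a0 => <-.
by apply: eq_card => b; rewrite !inE tr_col_mx mul_mx_row row_mx_eq0.
Qed.

Lemma sub_row_neq0 n (u v : 'rV[F]_n) : u != 0 -> (u <= v)%MS ->
  exists2 t, t != 0 & v = t *: u.
Proof.
move=> u0 /sub_rVP[t ut]; have t0 : t != 0.
  by apply: contraNneq u0 => t0; rewrite ut t0 scale0r.
by exists t^-1; rewrite ?invr_eq0 // ut scalerA mulVf // scale1r.
Qed.

Lemma sub_row_sym n (u v : 'rV[F]_n) :
  u != 0 -> v != 0 -> (u <= v)%MS = (v <= u)%MS.
Proof.
move=> u0 v0; apply/idP/idP => /sub_row_neq0[] // t _ ->; exact: scalemx_sub.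
Qed.

(** A scaled unit vector at a nonzero coordinate of [a] works. It is a left inverse of the column
    [a^T], and serves to cancel one factor of an outer product. *)
Lemma exists_dual n (a : 'rV[F]_n) : a != 0 -> exists e : 'rV_n, e *m a^T = 1%:M.
Proof.
move=> a0; have [i ai] : exists i, a 0 i != 0.
  apply/existsP; apply: contraNT a0; rewrite negb_exists => /forallP a0.
  by apply/eqP/rowP => i; rewrite mxE; apply/eqP/negPn/a0.
exists ((a 0 i)^-1 *: delta_mx 0 i); rewrite -scalemxAl -rowE.
by apply/matrixP => j l; rewrite !ord1 !mxE eqxx mulVf.
Qed.

Lemma mul_col_row_eq0 m n (a : 'rV[F]_m) (b : 'rV_n) :
  (a^T *m b == 0) = (a == 0) || (b == 0).
Proof.
apply/idP/idP => [/eqP ab0|]; last first.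
  by case/orP => /eqP ->; rewrite ?trmx0 ?mul0mx ?mulmx0.
apply/orP; case: (altP (a =P 0)) => a0; [by left | right].
have [e ea] := exists_dual a0.
by rewrite -[b]mul1mx -ea -mulmxA ab0 mulmx0.
Qed.

Lemma mul_row_eq0 m n (A : 'cV[F]_m) (b : 'rV_n) :
  b != 0 -> (A *m b == 0) = (A == 0).
Proof.
by move=> b0; rewrite -{1}[A]trmxK mul_col_row_eq0 (negPf b0) orbF trmx_eq0.
Qed.

Lemma mxrank1P m n (A : 'M[F]_(m, n)) : \rank A = 1%N ->
  exists (a : 'rV[F]_m) (b : 'rV[F]_n), [/\ a != 0, b != 0 & A = a^T *m b].
Proof.
move=> rA; have A0 : A != 0 by rewrite -mxrank_eq0 rA.
move: (mulmx_base A); move: (col_base A) (row_base A); rewrite rA => c b A_E.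
exists c^T, b; rewrite trmxK -A_E trmx_eq0; split => //.
  by apply: contraNneq A0 => c0; rewrite -A_E c0 mul0mx.
by apply: contraNneq A0 => b0; rewrite -A_E b0 mulmx0.
Qed.

Lemma rank_col_row m n (a : 'rV[F]_m) (b : 'rV_n) :
  a != 0 -> b != 0 -> \rank (a^T *m b) = 1%N.
Proof.
move=> a0 b0; apply/eqP; rewrite eqn_leq lt0n mxrank_eq0 mul_col_row_eq0.
by rewrite (negPf a0) (negPf b0) andbT (leq_trans (mxrankM_maxl _ _)) ?rank_leq_col.
Qed.

(** Multiplying by a dual of [b'] shows that [a'] is a multiple of [a]; a dual of [a] then
    determines [b']. So a rank-one matrix has q - 1 factorisations. *)
Lemma outer_eq m n (a a' : 'rV[F]_m) (b b' : 'rV_n) : a != 0 -> b != 0 ->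
  a'^T *m b' = a^T *m b -> exists2 t, t != 0 & a' = t *: a /\ b' = t^-1 *: b.
Proof.
move=> a0 b0 E; have : a^T *m b != 0 by rewrite mul_col_row_eq0 negb_or a0.
rewrite -E mul_col_row_eq0 negb_or => /andP[a'0 b'0].
have [e eb] := exists_dual b'0.
have a'E : a'^T = a^T *m (b *m e^T).
  by rewrite mulmxA -E -mulmxA -[b' *m _]trmxK trmx_mul trmxK eb trmx1 mulmx1.
pose t := (b *m e^T) 0 0.
have {}a'E : a' = t *: a.
  by apply: trmx_inj; rewrite a'E [b *m _]mx11_scalar mul_mx_scalar linearZ.
have t0 : t != 0 by apply: contraNneq a'0 => t0; rewrite a'E t0 scale0r.
exists t => //; split=> //; have [f fa] := exists_dual a0.
rewrite -[b]mul1mx -fa -mulmxA -E a'E linearZ /= -scalemxAl -scalemxAr.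
by rewrite mulmxA fa mul1mx scalerA mulVf // scale1r.
Qed.

(* If [b] and [b'] are independent, a matrix with rows [b], [b'] is row free,
   so the sum has the rank of the matrix with columns [a], [a']. *)
Lemma rank_outer_sum m n (a a' : 'rV[F]_m) (b b' : 'rV_n) :
  a != 0 -> b != 0 -> (\rank (a^T *m b + a'^T *m b')%R <= 1)%N ->
  (a' <= a)%MS || (b' <= b)%MS.
Proof.
move=> a0 b0; rewrite -mul_row_col -tr_col_mx.
case: (boolP (b' <= b)%MS) => [|b'b]; first by rewrite orbT.
rewrite mxrankMfree; last first.
  by rewrite /row_free -addsmxE mxrank_add_row rank_rV b0 b'b.
by rewrite mxrank_tr -addsmxE mxrank_add_row rank_rV a0 orbF; case: (a' <= a)%MS.
Qed.

End RowSpaces.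

(** * Planes of flags of PG(2,q) and nilpotent 3 x 3 matrices *)

Section Matrices3.
Import GRing.Theory.
Local Open Scope ring_scope.
Variable F : finFieldType.
Implicit Types (M N P : 'M[F]_3) (a b c d u v : 'rV[F]_3).
Implicit Types x y : 'rV[F]_3 * 'rV[F]_3.

(** * The coordinates [rho], and the quadric in terms of traces and the characteristic polynomial *)

Lemma big_inord3 (f : 'I_3 -> F) :
  \sum_i f i = f (inord 0) + f (inord 1) + f (inord 2).
Proof.
rewrite !big_ord_recl big_ord0 addr0 addrA.
by congr (f _ + f _ + f _); apply/val_inj; rewrite /= inordK.
Qed.

Lemma inord3P (Q : 'I_3 -> Prop) :
  Q (inord 0) -> Q (inord 1) -> Q (inord 2) -> forall i, Q i.
Proof.
move=> Q0 Q1 Q2 i; rewrite -(inord_val i).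
by case: i => [[|[|[|i]]] hi].
Qed.

Lemma rho_X M k : (0 < k < 10)%N ->
  X k (rho M) = M (inord (k.-1 %/ 3)) (inord (k.-1 %% 3)).
Proof. by case: k => [|k] //= hk; rewrite /X /rho mxE /= inordK. Qed.

(** The right-hand side is minus the sum of the principal 2 x 2 minors, that is, minus the
    coefficient of X in the characteristic polynomial of [M]. *)
Lemma Q8_rho M :
  Q8 (rho M) = M (inord 0) (inord 1) * M (inord 1) (inord 0)
   - M (inord 0) (inord 0) * M (inord 1) (inord 1)
   + M (inord 0) (inord 2) * M (inord 2) (inord 0)
   - M (inord 0) (inord 0) * M (inord 2) (inord 2)
   + M (inord 1) (inord 2) * M (inord 2) (inord 1)
   - M (inord 1) (inord 1) * M (inord 2) (inord 2).
Proof. by rewrite /Q8 !rho_X. Qed.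

Lemma rho_sub_Pi M : (rho M <= Pi F)%MS = (\tr M == 0).
Proof. by rewrite sub_Pi !rho_X // /mxtrace big_inord3. Qed.

Lemma rhoD M N : rho (M + N) = rho M + rho N.
Proof. by apply/rowP => i; rewrite !mxE. Qed.

Lemma rhoZ (t : F) M : rho (t *: M) = t *: rho M.
Proof. by apply/rowP => i; rewrite !mxE. Qed.

Definition unrho (v : 'rV[F]_9) : 'M[F]_3 :=
  \matrix_(i, j) v 0 (inord (3 * i + j)).

Lemma rhoK : cancel (@rho F) unrho.
Proof.
move=> M; apply/matrixP => i j; rewrite !mxE inordK; last first.
  by case: i j => [[|[|[|i]]] hi] [[|[|[|j]]] hj].
rewrite mulnC divnMDl // divn_small // addn0 modnMDl modn_small //.
by rewrite !inord_val.
Qed.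

Lemma unrhoK : cancel unrho (@rho F).
Proof.
move=> v; apply/rowP => k; rewrite !mxE !inordK ?ltn_mod ?ltn_divLR //.
by rewrite mulnC -divn_eq inord_val.
Qed.

Lemma polar_Q8_rho M N :
  polar_form (@Q8 F) (rho M) (rho N) = \tr (M *m N) - \tr M * \tr N.
Proof.
rewrite /polar_form -rhoD !Q8_rho /mxtrace !big_inord3 !mxE !big_inord3.
ring.
Qed.

(** Newton's identity, written without a division by 2 so that it covers even q. *)
Lemma tr_sqr M : \tr (M *m M) = 2 * Q8 (rho M) + \tr M ^+ 2.
Proof.
rewrite Q8_rho /mxtrace !big_inord3 !mxE !big_inord3.
ring.
Qed.


(* Cayley-Hamilton for a matrix whose characteristic polynomial is X^3 - t. *)
Lemma cube_scalar M : \tr M = 0 -> Q8 (rho M) = 0 ->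
  exists t : F, M *m M *m M = t%:M.
Proof.
move=> tr0 q0.
(* This is the determinant, expanded along the first row. What is checked entrywise is the general
   Cayley-Hamilton identity, before the trace and [Q8] are set to 0. *)
exists (M (inord 0) (inord 0) * (M (inord 1) (inord 1) * M (inord 2) (inord 2)
    - M (inord 1) (inord 2) * M (inord 2) (inord 1))
  - M (inord 0) (inord 1) * (M (inord 1) (inord 0) * M (inord 2) (inord 2)
    - M (inord 1) (inord 2) * M (inord 2) (inord 0))
  + M (inord 0) (inord 2) * (M (inord 1) (inord 0) * M (inord 2) (inord 1)
    - M (inord 1) (inord 1) * M (inord 2) (inord 0))).
set t := (X in X%:M); suff : M *m M *m M
    = \tr M *: (M *m M) + Q8 (rho M) *: M + t%:M.
  by rewrite tr0 q0 !scale0r !add0r.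
rewrite {}/t Q8_rho /mxtrace big_inord3 {tr0 q0}; apply/matrixP.
by apply: inord3P; apply: inord3P; rewrite !(mxE, big_inord3) -!val_eqE /= !inordK //=;
  ring.
Qed.

(** Flags are pairs of vectors here: each flag of PG(2,q) has (q - 1)^2 representatives, whence the
    powers of [q.-1] in the counts. *)
Definition flag x := [&& x.1 != 0, x.2 != 0 & x.1 *m x.2^T == 0].

(* The plane pi_x of the hexagon point x = <x.1^T x.2>, lifted to matrices. *)
Definition flag_plane x : {set 'M[F]_3} :=
  [set x.1^T *m y.1 + y.2^T *m x.2 |
    y in [set y : 'rV[F]_3 * 'rV[F]_3 |
            (y.1 *m x.1^T == 0) && (y.2 *m x.2^T == 0)]].

Lemma flag_planeP a b N :
  reflect (exists c d, [/\ c *m a^T = 0, d *m b^T = 0 & N = a^T *m c + d^T *m b])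
          (N \in flag_plane (a, b)).
Proof.
apply: (iffP imsetP) => [[[c d]]|[c [d [ca db ->]]]].
  by rewrite inE /= => /andP[/eqP ca /eqP db] ->; exists c, d.
by exists (c, d); rewrite // inE /= ca db eqxx.
Qed.

Lemma flag_plane0 x : 0 \in flag_plane x.
Proof.
case: x => a b; apply/flag_planeP; exists 0, 0.
by rewrite trmx0 !mul0mx mulmx0 addr0.
Qed.

Lemma flag_plane_scale a b s t N : s != 0 -> t != 0 ->
  N \in flag_plane (a, b) -> N \in flag_plane (s *: a, t *: b).
Proof.
move=> s0 t0 /flag_planeP[c [d [ca db ->]]]; apply/flag_planeP.
exists (s^-1 *: c), (t^-1 *: d).
rewrite !linearZ /= -!scalemxAl ca db !scaler0; split=> //.
by rewrite !scalerA mulfV // mulVf // !scale1r.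
Qed.

Lemma outer_flag_plane a b : a *m b^T = 0 -> a^T *m b \in flag_plane (a, b).
Proof.
move=> ab; apply/flag_planeP; exists b, 0.
by rewrite trmx0 !mul0mx addr0 (eqP (_ : b *m a^T == 0)) // mul_tr_eq0C ab.
Qed.

Lemma flag_plane_kerr a b N : a *m b^T = 0 -> N \in flag_plane (a, b) ->
  a *m N^T = 0.
Proof.
move=> ab /flag_planeP[c [d [ca db ->]]]; apply: trmx_inj.
have ba : b *m a^T = 0 by apply/eqP; rewrite mul_tr_eq0C ab.
by rewrite trmx_mul trmxK trmx0 mulmxDl -!mulmxA ca ba !mulmx0 addr0.
Qed.

Lemma flag_plane_kerl a b N : a *m b^T = 0 -> N \in flag_plane (a, b) ->
  b *m N = 0.
Proof.
move=> ab /flag_planeP[c [d [ca db ->]]].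
have /eqP ba : b *m a^T == 0 by rewrite mul_tr_eq0C ab.
have /eqP bd : b *m d^T == 0 by rewrite mul_tr_eq0C db.
by rewrite mulmxDr !mulmxA ba bd !mul0mx addr0.
Qed.

Lemma tr_outer a b : \tr (a^T *m b) = (b *m a^T) 0 0.
Proof. by rewrite mxtrace_mulC /mxtrace big_ord1. Qed.

Lemma flag_plane_tr x N : N \in flag_plane x -> \tr N = 0.
Proof.
case: x => a b /flag_planeP[c [d [ca db ->]]].
have /eqP bd : b *m d^T == 0 by rewrite mul_tr_eq0C db.
by rewrite mxtraceD !tr_outer ca bd mxE addr0.
Qed.

Lemma rank_flag_plane x N : flag x -> N \in flag_plane x -> N != 0 ->
  (0 < \rank N < 3)%N.
Proof.
case: x => a b /and3P[/= a0 b0 /eqP ab] Nx N0; rewrite lt0n mxrank_eq0 N0 /=.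
have := mxrank_ker N; have : (b <= kermx N)%MS.
  by apply/sub_kermxP; apply: flag_plane_kerl Nx.
by move/mxrankS; rewrite rank_rV b0; lia.
Qed.

(** With [e] dual to [a], split off [a^T *m (e *m N)]. Each row of the remainder is [u *m N] for
    some [u] orthogonal to [a], hence a multiple of [b]. *)
Lemma flag_planeI a b N : a != 0 -> b != 0 -> a *m N^T = 0 -> b *m N = 0 ->
  (forall u, u *m a^T = 0 -> (u *m N <= b)%MS) -> a *m b^T = 0 ->
  N \in flag_plane (a, b).
Proof.
move=> a0 b0 aN bN HN ab; have [e ea] := exists_dual a0.
have /eqP Na : N *m a^T == 0 by rewrite mul_tr_eq0C aN.
have : (N - a^T *m (e *m N) <= b)%MS.
  apply/row_subP => i; rewrite rowE mulmxBr.
  rewrite !mulmxA -mulmxBl; apply: HN.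
  by rewrite mulmxBl -!mulmxA ea mulmx1 subrr.
case/submxP => D ND; apply/flag_planeP; exists (e *m N), D^T.
have N_E : N = a^T *m (e *m N) + D *m b by rewrite -ND addrC subrK.
split; [by rewrite -mulmxA Na mulmx0 | | by rewrite trmxK].
(* The column [D] of the remainder must be orthogonal to [b]; this follows since [b] kills both [N]
   and [a^T]. *)
have : b *m D *m b == 0.
  rewrite -mulmxA -ND mulmxBr bN !mulmxA.
  by rewrite (eqP (_ : b *m a^T == 0)) ?mul0mx ?subrr // mul_tr_eq0C ab.
by rewrite mul_row_eq0 // -trmx_mul => /eqP ->; rewrite trmx0.
Qed.

(* Strictly triangular with respect to some flag. *)
Definition nilpotent N := [exists x, flag x && (N \in flag_plane x)].

Lemma nilpotentP N : reflect (exists a b, flag (a, b) /\ N \in flag_plane (a, b))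
  (nilpotent N).
Proof.
apply: (iffP existsP) => [[[a b] /andP[]]|[a [b [ab Nab]]]]; first by exists a, b.
by exists (a, b); rewrite ab.
Qed.

Lemma ker_rank2 n (N : 'M[F]_(3, n)) a u :
  \rank N = 2%N -> a != 0 -> a *m N = 0 -> u *m N = 0 -> (u <= a)%MS.
Proof.
move=> r2 a0 /sub_kermxP aN /sub_kermxP uN; apply: (submx_trans uN).
by rewrite -(geq_leqif (mxrank_leqif_sup aN)) mxrank_ker r2 rank_rV a0.
Qed.

(** The flag is read off a rank-one matrix [a^T *m b]: off [N] itself if it has rank 1, off its
    square if it has rank 2. The vanishing trace of that matrix is the incidence of [a] and [b]. *)
Lemma nilpotent_cube N : N != 0 -> \tr N = 0 -> N *m N *m N = 0 -> 
  \tr (N *m N) = 0 -> nilpotent N.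
Proof.
move=> N0 tr0 N3 trN2.
have r3 : (\rank N < 3)%N.
  rewrite ltn_neqAle rank_leq_row andbT; apply: contraNneq N0 => r3.
  have Nu : N \in unitmx.
    by rewrite -row_free_unit /row_free r3.
  have NN : N *m N = 0 by rewrite -[LHS](mulmxK Nu) N3 mul0mx.
  by apply/eqP; rewrite -[LHS](mulmxK Nu) NN mul0mx.
have r0 : (0 < \rank N)%N by rewrite lt0n mxrank_eq0.
have [r1|r2] : \rank N = 1%N \/ \rank N = 2%N by lia.
  have [a [b [a0 b0 N_E]]] := mxrank1P r1.
  have ab : a *m b^T = 0.
    apply/eqP; rewrite mul_tr_eq0C; apply/eqP; move: tr0; rewrite N_E tr_outer => h.
    by rewrite [_ *m _]mx11_scalar h raddf0.
  apply/nilpotentP; exists a, b; split; last by rewrite N_E; apply: outer_flag_plane.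
  by rewrite /flag /= a0 b0 ab eqxx.
(* Sylvester's rank inequality for N times N gives rank at least 1, and for the square times N,
   which is 0, rank at most 1. *)
have rN2 : \rank (N *m N) = 1%N.
  have := mxrank_mul_min N N; have := mxrank_mul_min (N *m N) N.
  rewrite N3 mxrank0 r2; by case: (\rank _) => [|[|n]] //; rewrite addn2 subSS.
have [a [b [a0 b0 N2E]]] := mxrank1P rN2.
have bN : b *m N = 0.
  apply/eqP; move/eqP: N3; rewrite N2E -mulmxA mul_col_row_eq0.
  by rewrite (negPf a0).
have aN : a *m N^T = 0.
  apply/eqP; rewrite mul_tr_eq0C; move/eqP: N3.
  by rewrite -mulmxA N2E mulmxA mul_row_eq0.
have ab : a *m b^T = 0.
  apply/eqP; rewrite mul_tr_eq0C; apply/eqP; move: trN2; rewrite N2E tr_outer => h.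
  by rewrite [_ *m _]mx11_scalar h raddf0.
apply/nilpotentP; exists a, b; split; first by rewrite /flag /= a0 b0 ab eqxx.
apply: flag_planeI => // u ua; apply: ker_rank2 r2 b0 bN _.
by rewrite -mulmxA N2E mulmxA ua mul0mx.
Qed.

(** In rank 2 both kernels are lines, so [a] and [b] are proportional to the flag that witnesses
    nilpotency. In rank 1, N is [c^T *m d]: either [c] is a multiple of [a], or [b] and [d] are both
    orthogonal to the independent vectors [a] and [c], hence proportional. *)
Lemma flag_planeE a b N : nilpotent N -> N != 0 -> flag (a, b) ->
  (N \in flag_plane (a, b)) = (a *m N^T == 0) && (b *m N == 0).
Proof.
move=> /nilpotentP[u [v [uv Nuv]]] N0 /and3P[/= a0 b0 /eqP ab].
apply/idP/andP => [Nab|[/eqP aN /eqP bN]].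
  by rewrite (flag_plane_kerr ab Nab) (flag_plane_kerl ab Nab).
have := rank_flag_plane uv Nuv N0.
case/and3P: uv => /= u0 v0 /eqP uv r12.
have [r1|r2] : \rank N = 1%N \/ \rank N = 2%N by lia.
  have [c [d [c0 d0 N_E]]] := mxrank1P r1.
  have ad : a *m d^T = 0.
    apply/eqP; move/eqP: aN.
    by rewrite N_E trmx_mul trmxK mulmxA mul_row_eq0.
  have bc : b *m c^T = 0.
    apply/eqP; move/eqP: bN.
    by rewrite N_E mulmxA mul_row_eq0.
  have dc : d *m c^T = 0.
    have := flag_plane_tr Nuv; rewrite N_E tr_outer => h.
    by rewrite [_ *m _]mx11_scalar h raddf0.
  have [ca|ca] := boolP (c <= a)%MS.
    have [t t0 ->] := sub_row_neq0 c0 ca; rewrite -[b]scale1r N_E.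
    apply: flag_plane_scale (oner_neq0 _) _ => //.
    apply/flag_planeP; exists d, 0; rewrite trmx0 !mul0mx addr0; by [].
  have db : (d <= b)%MS.
    apply: (@ker_rank2 _ (col_mx a c)^T) => //.
    - by rewrite mxrank_tr -addsmxE mxrank_add_row rank_rV a0 ca.
    - rewrite tr_col_mx mul_mx_row bc (eqP (_ : b *m a^T == 0)) ?row_mx0 //.
      by rewrite mul_tr_eq0C ab.
    - rewrite tr_col_mx mul_mx_row dc (eqP (_ : d *m a^T == 0)) ?row_mx0 //.
      by rewrite mul_tr_eq0C ad.
  have [t t0 ->] := sub_row_neq0 d0 db; rewrite N_E -[a]scale1r.
  apply: flag_plane_scale (oner_neq0 _) t0 _.
  apply/flag_planeP; exists 0, c; rewrite !mul0mx mulmx0 add0r; split=> //.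
  by apply/eqP; rewrite mul_tr_eq0C dc.
have ua : (a <= u)%MS.
  apply: (@ker_rank2 _ N^T) => //; rewrite ?mxrank_tr //.
  exact: flag_plane_kerr Nuv.
have vb : (b <= v)%MS.
  by apply: (@ker_rank2 _ N) => //; apply: flag_plane_kerl Nuv.
rewrite sub_row_sym // in ua; rewrite sub_row_sym // in vb.
have [s s0 ->] := sub_row_neq0 u0 ua; have [t t0 ->] := sub_row_neq0 v0 vb.
exact: flag_plane_scale.
Qed.

(** * The number of flags whose plane contains a given nilpotent matrix *)

Local Notation q := #|F|.

Lemma pred_sqr (n : nat) : (n ^ 2).-1 = (n.-1 * n.+1)%N.
Proof. case: n => // n; lia. Qed.

Lemma pred_cube (n : nat) : (n ^ 3).-1 = (n.-1 * (n ^ 2 + n + 1))%N.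
Proof. case: n => // n; lia. Qed.

(** For [a] orthogonal to [v], the vector [b] is orthogonal to [a] and [u]: there are q^2 - 1
    choices if [a] is a multiple of [u], and q - 1 otherwise. *)
Lemma card_flags_rank1 u v : u != 0 -> v != 0 -> u *m v^T = 0 ->
  #|[set x | flag x && ((x.1 *m v^T == 0) && (x.2 *m u^T == 0))]|
  = (q.-1 ^ 2 * (2 * q + 1))%N.
Proof.
move=> u0 v0 uv.
pose A a := (a != 0) && (a *m v^T == 0).
pose R a b := [&& b != 0, b *m u^T == 0 & b *m a^T == 0].
rewrite (_ : [set x | _] = [set x : 'rV_3 * 'rV_3 | A x.1 && R x.1 x.2]); last first.
  apply/setP => [[a b]]; rewrite !inE /flag /A /R /= (mul_tr_eq0C a b).
  by case: (a != 0) (b != 0) (_ *m v^T == 0) (_ *m a^T == 0) (_ *m u^T == 0)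
    => [] [] [] [] [].
rewrite card_pairs (eq_bigr (fun a => if (a <= u)%MS then (q ^ 2).-1 else q.-1)).
  have := sum_if_const A (fun a => a <= u)%MS (q ^ 2).-1 q.-1.
  rewrite {}/A card_left_ker_neq0 mxrank_tr rank_rV v0.
  have -> : [set a : 'rV_3 | (a != 0) && (a *m v^T == 0) && (a <= u)%MS]
          = [set a | (a != 0) && (a <= u)%MS].
    apply/setP => a; rewrite !inE; case: (a != 0) => //=.
    case: (boolP (a <= u)%MS) => [/sub_rVP[t ->]|]; rewrite ?andbF ?andbT //.
    by rewrite -scalemxAl uv scaler0 eqxx.
  rewrite card_line // pred_sqr; case: q => [|n] //=; nia.
move=> a _; rewrite card_orth2 //; by case: (a <= u)%MS.
Qed.

Lemma card_flags_nilpotent N : nilpotent N -> N != 0 ->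
  #|[set x | flag x && (N \in flag_plane x)]|
  = if \rank N == 1%N then (q.-1 ^ 2 * (2 * q + 1))%N else (q.-1 ^ 2)%N.
Proof.
move=> nN N0; case/nilpotentP: (nN) => u [v [uv Nuv]].
have r12 := rank_flag_plane uv Nuv N0.
rewrite (_ : [set x | _] = [set x | flag x && ((x.1 *m N^T == 0) && (x.2 *m N == 0))]);
  last first.
  apply/setP => -[a b]; rewrite !inE; case: (boolP (flag (a, b))) => //= ab.
  by rewrite flag_planeE.
case: eqP => r1.
  have [c [d [c0 d0 N_E]]] := mxrank1P r1.
  have dc : d *m c^T = 0.
    have := flag_plane_tr Nuv; rewrite N_E tr_outer => h.
    by rewrite [_ *m _]mx11_scalar h raddf0.
  rewrite -(@card_flags_rank1 c d) //; last by apply/eqP; rewrite mul_tr_eq0C dc.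
  apply: eq_card => x; rewrite !inE; congr (_ && (_ && _)).
    by rewrite N_E trmx_mul trmxK mulmxA mul_row_eq0.
  by rewrite N_E mulmxA mul_row_eq0.
have r2 : \rank N = 2%N by lia.
have aN := flag_plane_kerr _ Nuv; have bN := flag_plane_kerl _ Nuv.
case/and3P: uv => /= u0 v0 /eqP uv; have {}aN := aN uv; have {}bN := bN uv.
(* In rank 2 the flag is unique up to scaling, so its representatives form the product of two
   punctured lines. *)
rewrite expnS expn1 -{1}(card_line u0) -(card_line v0) -cardsX.
apply: eq_card => -[a b]; rewrite !inE /flag /=.
case: (a =P 0) => //= a0; case: (b =P 0) => //= [_|b0]; first by rewrite andbF.
apply/idP/andP => [/and3P[_ /eqP Na /eqP Nb]|[/sub_rVP[s ->] /sub_rVP[t ->]]].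
  split; first by apply: (@ker_rank2 _ N^T) => //; rewrite ?mxrank_tr.
  exact: (@ker_rank2 _ N).
rewrite linearZ /= -!scalemxAl -scalemxAr uv aN bN !scaler0 !eqxx //.
Qed.

End Matrices3.

(** * Eigenvectors of matrices with scalar cube *)

Section Eigen.
Import GRing.Theory.
Local Open Scope ring_scope.
Variable F : finFieldType.
Implicit Types (M N P : 'M[F]_3) (a b c d u v : 'rV[F]_3).
Implicit Types x y : 'rV[F]_3 * 'rV[F]_3.
Local Notation q := #|F|.

Lemma root_cube (w mu nu : F) : w ^+ 2 + w + 1 = 0 -> nu ^+ 3 = mu ^+ 3 ->
  [\/ nu = mu, nu = mu * w | nu = mu * w ^+ 2].
Proof.
move=> w0 nm.
have : (nu - mu) * (nu - mu * w) * (nu - mu * w ^+ 2) == 0.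
  (* The product is the difference of cubes modulo w^2 + w + 1; the last factor is the quotient of
     that division. *)
  apply/eqP; transitivity (nu ^+ 3 - mu ^+ 3 + (w ^+ 2 + w + 1) *
    (mu ^+ 2 * nu * w - nu ^+ 2 * mu - mu ^+ 3 * (w - 1))); first by ring.
  by rewrite nm w0 subrr mul0r addr0.
rewrite !mulf_eq0 !subr_eq0 -orbA => /or3P[] /eqP;
  [exact: Or31|exact: Or32|exact: Or33].
Qed.

(* [P] has the eigenvalues mu, mu w, mu w^2, each with a line of left
   eigenvectors; those for the last two are orthogonal to [a], and those for mu
   are not. *)
Lemma card_left_eigen_orth (w t : F) P a :
  w != 1 -> w ^+ 2 + w + 1 = 0 -> t != 0 -> P *m P *m P = t%:M ->
  \tr P = 0 -> \tr (P *m P) = 0 -> a != 0 -> (a *m P^T <= a)%MS ->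
  #|[set b : 'rV_3 | [&& b != 0, b *m a^T == 0 & (b *m P <= b)%MS]]| = (2 * q.-1)%N.
Proof.
move=> w1 w0 t0 P3 trP trP2 a0 /sub_rVP[mu aP].
have Pa : P *m a^T = mu *: a^T.
  by apply: trmx_inj; rewrite trmx_mul trmxK aP !linearZ /= trmxK.
have eigen_root (b : 'rV_3) nu : b != 0 -> b *m P = nu *: b -> nu ^+ 3 = t.
  move=> b0 bP; apply/eqP; rewrite -subr_eq0; apply: contraNT b0 => nt.
  have : (nu ^+ 3 - t) *: b == 0.
    rewrite scalerBl -[t *: b]mul_mx_scalar -P3 !mulmxA !(bP, =^~ scalemxAl) !scalerA.
    by rewrite -expr2 -exprSr subrr.
  by rewrite scalemx_eq0 (negPf nt).
have mu3 : mu ^+ 3 = t.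
  apply/eqP; rewrite -subr_eq0; apply: contraNT a0 => nt.
  have : (mu ^+ 3 - t) *: a^T == 0.
    rewrite scalerBl -[t *: a^T]mul_scalar_mx -P3 -!mulmxA !(Pa, =^~ scalemxAr) !scalerA.
    by rewrite -expr2 -exprSr subrr.
  by rewrite scalemx_eq0 (negPf nt) trmx_eq0.
have mu0 : mu != 0 by apply: contraNneq t0 => m0; rewrite -mu3 m0 expr0n.
have w3 : w ^+ 3 = 1.
  transitivity (1 + (w - 1) * (w ^+ 2 + w + 1)); first by ring.
  by rewrite w0 mulr0 addr0.
have wN0 : w != 0 by apply: contra_eqN w0 => /eqP ->; rewrite expr0n !add0r oner_eq0.
have w2w : w ^+ 2 != w.
  by rewrite expr2 -{3}[w]mulr1 (inj_eq (mulfI wN0)).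
have w21 : w ^+ 2 != 1.
  apply: contraNneq w1 => w21; rewrite -w3 exprS w21 mulr1 //.
(* In characteristic 3 the polynomial w^2 + w + 1 is (w - 1)^2, which would force w = 1. *)
have three0 : (3 : F) != 0.
  apply: contraNneq w1 => h3; suff : (w - 1) ^+ 2 == 0 by rewrite expf_eq0 subr_eq0.
  have -> : (w - 1) ^+ 2 = (w ^+ 2 + w + 1) - 3 * w by ring.
  by rewrite w0 h3 mul0r subrr.
pose r (i : 'I_3) := mu * w ^+ i.
have r3 i : r i ^+ 3 = t by rewrite exprMn exprAC w3 expr1n mulr1.
have r_inj : injective r.
  move=> i j /(mulfI mu0) h; apply/val_inj; move: h.
  case: i j => [[|[|[|i]]] hi] [[|[|[|j]]] hj] //= /eqP;
    rewrite ?expr0 ?expr1 ?(negPf w1) ?(negPf w2w) ?(negPf w21) //.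
  - by rewrite eq_sym (negPf w1).
  - by rewrite eq_sym (negPf w21).
  - by rewrite eq_sym (negPf w2w).
pose E i := eigenspace P (r i).
(* Every cube root r of t is an eigenvalue: if P - r were invertible, the factorisation of P^3 - r^3
   would give P^2 + rP + r^2 = 0, whose trace is 3r^2, not 0. *)
have E_gt0 i : (0 < \rank (E i))%N.
  rewrite lt0n mxrank_eq0; apply/eqP => Ei0.
  have Pu : P - (r i)%:M \in unitmx.
    by rewrite -row_free_unit -kermx_eq0 -/(eigenspace _ _) -/(E i) Ei0.
  have : (P - (r i)%:M) *m (P *m P + r i *: P + (r i ^+ 2)%:M) = 0.
    rewrite mulmxBl !mulmxDr -!scalemxAr mul_mx_scalar !mul_scalar_mx !mulmxA P3 -(r3 i).
    by apply/matrixP => k l; rewrite !mxE; ring.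
  move/(congr1 (mulmx (invmx (P - (r i)%:M)))); rewrite mulKmx // mulmx0.
  move/(congr1 mxtrace); rewrite !mxtraceD mxtraceZ trP trP2 mxtrace_scalar mxtrace0.
  rewrite mulr0 !add0r -mulr_natr => /eqP.
  rewrite mulf_eq0 (negPf three0) orbF expf_eq0 /= => /eqP ri0.
  by move: t0; rewrite -(r3 i) ri0 expr0n eqxx.
have /mxdirectP /= dE : mxdirect (\sum_i E i).
  by apply: mxdirect_sum_eigenspace => i j _ _; apply: r_inj.
(* Three independent nonzero subspaces of a 3-dimensional space are lines. *)
have rE i : \rank (E i) = 1%N.
  have := rank_leq_row (\sum_i E i)%MS; rewrite dE (bigD1 i) //= => h.
  have : (\sum_(j < 3 | j != i) 1 <= \sum_(j < 3 | j != i) \rank (E j))%N.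
    by apply: leq_sum => j _; apply: E_gt0.
  rewrite sum1_card cardC1 card_ord; move: (E_gt0 i) h.
  case: (\rank (E i)) => [|[|m]] // _ h.
  by move/(leq_add (leqnn m.+2))/leq_trans/(_ h); rewrite /= addn2.
have E_full : (1%:M <= \sum_i E i)%MS.
  by rewrite sub1mx /row_full dE (eq_bigr (fun=> 1%N)) // sum_nat_const card_ord.
have E_orth i (b : 'rV_3) : (b <= E i)%MS -> r i != mu -> b *m a^T = 0.
  move=> /eigenspaceP bP rmu; apply/eqP.
  have : (r i - mu) *: (b *m a^T) == 0.
    by rewrite scalerBl scalemxAl -bP -mulmxA Pa -scalemxAr subrr.
  by rewrite scalemx_eq0 subr_eq0 (negPf rmu).
(* Otherwise [a] would be orthogonal to all three eigenspaces, which span the space. *)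
have E_mu i (b : 'rV_3) : r i = mu -> (b <= E i)%MS -> b != 0 -> b *m a^T != 0.
  move=> ri bE b0; apply: contraNneq a0 => ba.
  have : a *m 1%:M == 0; last by rewrite mulmx1.
  rewrite mulmx1; case/sub_sumsmxP: E_full => z zE.
  rewrite -trmx_eq0 -[a^T]mul1mx zE mulmx_suml big1 // => j _.
  rewrite -mulmxA; have [->|rj] := eqVneq j i.
    have : (E i <= b)%MS by rewrite -(geq_leqif (mxrank_leqif_sup bE)) rE rank_rV b0.
    by case/submxP => D ->; rewrite -mulmxA ba !mulmx0.
  rewrite (_ : E j *m a^T = 0) ?mulmx0 //; apply/row_matrixP => l.
  rewrite row_mul row0; apply: (E_orth j); first exact: row_sub.
  by rewrite -ri (inj_eq r_inj).
have r0 : r (inord 0) = mu by rewrite /r inordK ?expr0 ?mulr1.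
have r1 : r (inord 1) = mu * w by rewrite /r inordK.
have r2 : r (inord 2) = mu * w ^+ 2 by rewrite /r inordK.
have rk i : #|[set b : 'rV_3 | (b != 0) && (b <= E i)%MS]| = q.-1.
  by rewrite card_sub_neq0 rE.
rewrite mul2n -addnn -{1}(rk (inord 1)) -(rk (inord 2)) -cardsUI.
rewrite [X in (_ + X)%N]eq_card0 ?addn0; last first.
  move=> b; rewrite !inE; apply/negP.
  move=> /andP[/andP[b0 /eigenspaceP b1] /andP[_ /eigenspaceP]].
  rewrite b1 => /eqP; rewrite -subr_eq0 -scalerBl scalemx_eq0 (negPf b0) orbF subr_eq0.
  by rewrite (inj_eq r_inj) -val_eqE /= !inordK.
apply: eq_card => b; rewrite !inE -andb_orr; case: (eqVneq b 0) => //= b0.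
apply/andP/orP => [[/eqP ba /sub_rVP[nu bP]]|h].
  have := eigen_root b nu b0 bP; rewrite -mu3 => /(root_cube w0)[] nuE.
  - have bE : (b <= E (inord 0))%MS by apply/eigenspaceP; rewrite r0 -nuE.
    by have := E_mu _ b r0 bE b0; rewrite ba eqxx.
  - by left; apply/eigenspaceP; rewrite r1 -nuE.
  - by right; apply/eigenspaceP; rewrite r2 -nuE.
have [i [/eigenspaceP bE ri]] : exists i, (b <= E i)%MS /\ r i != mu.
  case: h => h; [exists (inord 1)|exists (inord 2)]; split=> //.
    by rewrite r1 -{2}[mu]mulr1 (inj_eq (mulfI mu0)).
  by rewrite r2 -{2}[mu]mulr1 (inj_eq (mulfI mu0)).
rewrite (E_orth i) ?eqxx //; last exact/eigenspaceP.
by rewrite bE scalemx_sub.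
Qed.

End Eigen.

(** * Invariant flags and planes in a polar hyperplane *)

Section InvFlags.
Import GRing.Theory.
Local Open Scope ring_scope.
Variable F : finFieldType.
Implicit Types (M N P : 'M[F]_3) (a b c d u v : 'rV[F]_3).
Implicit Types x y : 'rV[F]_3 * 'rV[F]_3.
Local Notation q := #|F|.

Lemma eigen_cube0 M u : M *m M *m M = 0 -> u != 0 ->
  (u *m M <= u)%MS = (u *m M == 0).
Proof.
move=> M3 u0; apply/idP/eqP => [/sub_rVP[t uM]|->]; last exact: sub0mx.
have : t ^+ 3 *: u == 0.
  rewrite -(mulmx0 _ u) -M3 !mulmxA !(uM, =^~ scalemxAl) !scalerA.
  by rewrite -expr2 -exprSr.
by rewrite scalemx_eq0 (negPf u0) orbF expf_eq0 uM => /eqP ->; rewrite scale0r.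
Qed.

(** [P] acts on points as column vectors, hence through the transpose on [x.1], and on lines as row
    vectors. *)
Definition inv_flag P x := flag x && ((x.1 *m P^T <= x.1)%MS && (x.2 *m P <= x.2)%MS).

Definition eigenvectors P : {set 'rV[F]_3} :=
  [set a | (a != 0) && (a *m P^T <= a)%MS].

(** The boolean [nilpotent P], read as 0 or 1, merges the cases A = 2e - 1 and A = 2e, each
    multiplied by (q - 1)^2. *)
Lemma card_inv_flags P : q = 1 %[mod 3] -> P != 0 -> \tr P = 0 -> Q8 (rho P) = 0 ->
  (#|[set x | inv_flag P x]| + nilpotent P * q.-1 ^ 2
  = 2 * q.-1 * #|eigenvectors P|)%N.
Proof.
move=> hF P0 trP qP; have [t P3] := cube_scalar trP qP.
have trP2 : \tr (P *m P) = 0 by rewrite tr_sqr trP qP mulr0 expr0n addr0.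
have [t0|t0] := eqVneq t 0.
  (* The only eigenvalue is 0, so a flag is invariant exactly when both its vectors are killed by P,
     that is, when P lies in its plane. *)
  rewrite t0 raddf0 in P3; have nP := nilpotent_cube P0 trP P3 trP2.
  rewrite (_ : [set x | _] = [set x | flag x && (P \in flag_plane x)]); last first.
    apply/setP => -[a b]; rewrite !inE /inv_flag; case: (boolP (flag _)) => //= ab.
    rewrite flag_planeE //; case/and3P: ab => /= a0 b0 _.
    by rewrite !eigen_cube0 // -!trmx_mul mulmxA P3 trmx0.
  rewrite card_flags_nilpotent // nP.
  rewrite (_ : eigenvectors P = [set a : 'rV_3 | (a != 0) && (a *m P^T == 0)]).
    rewrite card_left_ker_neq0 mxrank_tr.
    case/nilpotentP: nP => a [b [ab Pab]]; have := rank_flag_plane ab Pab P0.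
    case: (\rank P) => [|[|[|n]]] //= _; rewrite ?pred_sqr; case: q => [|n] //=; lia.
  apply/setP => a; rewrite !inE; case: (eqVneq a 0) => //= a0.
  by rewrite eigen_cube0 // -!trmx_mul mulmxA P3 trmx0.
have -> : nilpotent P = false.
  apply/negbTE/negP => /nilpotentP[a [b [/and3P[/= a0 b0 /eqP ab] Pab]]].
  have := flag_plane_kerl ab Pab => bP.
  have : t *: b == 0 by rewrite -mul_mx_scalar -P3 !mulmxA bP !mul0mx.
  by rewrite scalemx_eq0 (negPf t0) (negPf b0).
have [w w1 w0] := cube_root1 hF.
rewrite mul0n addn0.
rewrite (_ : [set x | _] = [set x : 'rV_3 * 'rV_3 |
  ((x.1 != 0) && (x.1 *m P^T <= x.1)%MS) &&
  [&& x.2 != 0, x.2 *m x.1^T == 0 & (x.2 *m P <= x.2)%MS]]); last first.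
  apply/setP => -[a b]; rewrite !inE /inv_flag /flag /= (mul_tr_eq0C b).
  by case: (a != 0) (b != 0) (_ *m b^T == 0) (a *m _ <= _)%MS => [] [] [] [].
rewrite (card_pairs (fun a : 'rV_3 => (a != 0) && (a *m P^T <= a)%MS)
  (fun a b : 'rV_3 => [&& b != 0, b *m a^T == 0 & (b *m P <= b)%MS])).
rewrite (eq_bigr (fun=> (2 * q.-1)%N)); first by rewrite sum_nat_cond_const mulnC.
by move=> a /andP[a0 aP]; exact: (card_left_eigen_orth w1 w0 t0 P3).
Qed.

(** The trace condition is one linear equation on a 3-dimensional space. It is trivial exactly when
    the row made of [a *m P^T] and [b *m P] depends on the rows (a, 0) and (0, b). *)
Lemma card_flag_plane_perp P x : flag x ->
  #|[set N in flag_plane x | \tr (P *m N) == 0]|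
  = (q ^ (if inv_flag P x then 3 else 2))%N.
Proof.
case: x => a b; rewrite /inv_flag.
case: (boolP (flag _)) => // /and3P[/= a0 b0 /eqP ab] _.
pose f (y : 'rV[F]_3 * 'rV[F]_3) := a^T *m y.1 + y.2^T *m b.
pose T := [set y : 'rV[F]_3 * 'rV[F]_3 | [&& y.1 *m a^T == 0, y.2 *m b^T == 0
  & \tr (P *m f y) == 0]].
have ba : b *m a^T = 0 by apply/eqP; rewrite mul_tr_eq0C ab.
have -> : [set N in flag_plane (a, b) | \tr (P *m N) == 0] = f @: T.
  apply/setP => N; rewrite !inE; apply/andP/imsetP.
    case=> /imsetP[y]; rewrite inE /= => /andP[ya yb] NE trN.
    by exists y; rewrite ?inE ?ya ?yb /f -?NE.
  case=> y; rewrite inE => /and3P[ya yb trN] ->; split=> //.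
  by apply/imsetP; exists y; rewrite // inE ya yb.
(* The parameters (c, d) of a matrix of the plane are determined up to adding a multiple of (b,
   -a). *)
have fibre : {in T, forall y, #|[set z in T | f z == f y]| = q}.
  move=> [c d]; rewrite inE => /and3P[/= /eqP ca /eqP db trf].
  pose g (t : F) := (c + t *: b, d - t *: a).
  have g_inj : injective g.
    move=> s t [/addrI /eqP]; rewrite -subr_eq0 -scalerBl scalemx_eq0 (negPf b0).
    by rewrite orbF subr_eq0 => /eqP.
  have fg t : f (g t) = f (c, d).
    rewrite /f /= mulmxDr [(_ - _)^T]linearB /= mulmxBl -scalemxAr.
    rewrite [(t *: a)^T]linearZ /= -scalemxAl.
    by rewrite addrACA subrr addr0.
  rewrite -(card_imset _ g_inj); apply: eq_card => -[c' d']; rewrite !inE /=.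
  apply/andP/imsetP => [[/and3P[/eqP ca' /eqP db' _] /eqP E]|[t _ E]].
    have [e ea] := exists_dual a0.
    have {}E : a^T *m (c' - c) = (d - d')^T *m b.
      have -> : (d - d')^T = d^T - d'^T by rewrite linearB.
      rewrite mulmxBr mulmxBl; apply/eqP.
      by rewrite subr_eq [_ + a^T *m c]addrC addrA -[_ + d^T *m b]E addrK.
    pose t := (e *m (d - d')^T) 0 0; exists t => //.
    have c_E : c' - c = t *: b.
      by rewrite -[LHS]mul1mx -ea -mulmxA E mulmxA [e *m _]mx11_scalar mul_scalar_mx.
    have d_E : d - d' = t *: a.
      apply/eqP; rewrite -subr_eq0 -trmx_eq0 -(mul_row_eq0 _ b0).
      rewrite [(_ - t *: a)^T]linearB /= mulmxBl -E c_E.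
      by rewrite [(t *: a)^T]linearZ /= -scalemxAl -scalemxAr subrr.
    by rewrite /g -c_E -d_E addrC subrK subKr.
  have fE : f (c', d') = f (c, d) by rewrite E fg.
  case: E fE => -> -> ->; rewrite eqxx trf; split=> //.
  by rewrite mulmxDl mulmxBl -!scalemxAl ca db ab ba !scaler0 addr0 subr0 eqxx.
have := card_fibres fibre.
(* The three rows of [B] are the three linear conditions on (c, d) that define [T]. *)
pose B := col_mx (block_mx a 0 0 b) (row_mx (a *m P^T) (b *m P)).
have -> : #|T| = (q ^ (6 - \rank B))%N.
  rewrite -mxrank_tr -[6%N]/(3 + 3)%N -card_left_ker.
  pose h (y : 'rV[F]_3 * 'rV[F]_3) := row_mx y.1 y.2.
  have h_inj : injective h by move=> [? ?] [? ?] /eq_row_mx[/= -> ->].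
  rewrite -(card_imset _ h_inj); apply: eq_card => z; rewrite inE.
  have hT y : (h y *m B^T == 0) = (y \in T).
    rewrite inE /B /h /f tr_col_mx mul_mx_row row_mx_eq0 tr_block_mx mul_row_block.
    rewrite !trmx0 !mulmx0 add0r addr0 row_mx_eq0 -andbA; congr [&& _, _ & _].
    rewrite tr_row_mx mul_row_col mulmxDr mxtraceD.
    have -> : \tr (P *m (a^T *m y.1)) = \tr (y.1 *m (a *m P^T)^T).
      by rewrite mulmxA mxtrace_mulC trmx_mul trmxK.
    have -> : \tr (P *m (y.2^T *m b)) = \tr (y.2 *m (b *m P)^T).
      by rewrite mulmxA mxtrace_mulC -mxtrace_tr !trmx_mul trmxK mulmxA.
    by rewrite -mxtraceD trace_mx11 -mx11_eq0.
  apply/imsetP/eqP => [[y yT ->]|Bz]; first by apply/eqP; rewrite hT.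
  exists (lsubmx z, rsubmx z); last by rewrite /h hsubmxK.
  by rewrite -hT /h hsubmxK Bz.
have rB : \rank B = (3 - ((a *m P^T <= a) && (b *m P <= b))%MS)%N.
  rewrite /B -addsmxE mxrank_add_row rank_diag_block_mx !rank_rV a0 b0.
  have -> : (row_mx (a *m P^T) (b *m P) <= block_mx a 0 0 b)%MS
          = (a *m P^T <= a)%MS && (b *m P <= b)%MS.
    apply/submxP/andP => [[D]|[/submxP[s ->] /submxP[t ->]]].
      rewrite -[D]hsubmxK mul_row_block !mulmx0 addr0 add0r => /eq_row_mx[-> ->].
      by rewrite !submxMl.
    by exists (row_mx s t); rewrite mul_row_block !mulmx0 addr0 add0r.
  by case: andb.
have q0 : (0 < q)%N by apply: ltnW (card_finNzRing_gt1 F).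
by rewrite rB; case: andb => E; apply/eqP; rewrite -(eqn_pmul2l q0) -E -expnS.
Qed.

End InvFlags.

(** * Nilpotent matrices in a polar hyperplane *)

Section NilpotentPerp.
Import GRing.Theory.
Local Open Scope ring_scope.
Variable F : finFieldType.
Implicit Types (M N P : 'M[F]_3) (a b c d u v : 'rV[F]_3).
Implicit Types x y : 'rV[F]_3 * 'rV[F]_3.
Local Notation q := #|F|.

Lemma card_flags : #|[set x : 'rV[F]_3 * 'rV[F]_3 | flag x]|
  = ((q ^ 3).-1 * (q ^ 2).-1)%N.
Proof.
rewrite (_ : [set x | _] = [set x : 'rV_3 * 'rV_3 |
  (x.1 != 0) && ((x.2 != 0) && (x.2 *m x.1^T == 0))]); last first.
  by apply/setP => -[a b]; rewrite !inE /flag mul_tr_eq0C.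
rewrite (card_pairs (fun a => a != 0) (fun a b => (b != 0) && (b *m a^T == 0))).
rewrite (eq_bigr (fun=> (q ^ 2).-1)) ?sum_nat_cond_const ?card_neq0_rV // => a a0.
by rewrite card_left_ker_neq0 mxrank_tr rank_rV a0.
Qed.

Definition nilpotent_perp P : {set 'M[F]_3} :=
  [set N | [&& N != 0, nilpotent N & \tr (P *m N) == 0]].

Lemma tr_mul_outer P a b : \tr (P *m (a^T *m b)) = (b *m (a *m P^T)^T) 0 0.
Proof. by rewrite mulmxA mxtrace_mulC trmx_mul trmxK /mxtrace big_ord1. Qed.

Lemma nilpotent_outer a b : flag (a, b) -> nilpotent (a^T *m b).
Proof.
move=> ab; apply/nilpotentP; exists a, b; split=> //.
by case/and3P: ab => _ _ /eqP; apply: outer_flag_plane.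
Qed.

Lemma nilpotent_rank1 N : nilpotent N -> \rank N = 1%N ->
  exists a b, flag (a, b) /\ N = a^T *m b.
Proof.
move=> /nilpotentP[u [v [uv Nuv]]] /mxrank1P[a [b [a0 b0 NE]]]; exists a, b; split=> //.
rewrite /flag /= a0 b0 mul_tr_eq0C mx11_eq0 -tr_outer -NE.
by rewrite (flag_plane_tr Nuv) eqxx.
Qed.

(** Count pairs (a, b) with [b] orthogonal to [a] and to [a *m P^T]: there are q^2 - 1 choices of
    [b] if [a] is an eigenvector, and q - 1 otherwise. Each matrix arises from q - 1 pairs. *)
Lemma card_rank1_perp P :
  (q.-1 * #|[set N in nilpotent_perp P | \rank N == 1%N]| + #|eigenvectors P| * q.-1
  = #|eigenvectors P| * (q ^ 2).-1 + (q ^ 3).-1 * q.-1)%N.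
Proof.
pose A := [set x : 'rV[F]_3 * 'rV[F]_3 | (x.1 != 0) &&
  [&& x.2 != 0, x.2 *m x.1^T == 0 & x.2 *m (x.1 *m P^T)^T == 0]].
pose f x := x.1^T *m x.2.
have flagA x : (x \in A) = flag x && (\tr (P *m f x) == 0).
  by rewrite inE /flag /f tr_mul_outer -mx11_eq0 (mul_tr_eq0C x.1 x.2) -!andbA.
have -> : [set N in nilpotent_perp P | \rank N == 1%N] = f @: A.
  apply/setP => N; rewrite !inE; apply/andP/imsetP.
    case=> /and3P[N0 nN trN] /eqP rN; have [a [b [ab NE]]] := nilpotent_rank1 nN rN.
    by exists (a, b) => //; rewrite flagA ab /f -NE.
  case=> -[a b]; rewrite flagA => /andP[ab trf] ->; rewrite trf /f nilpotent_outer //.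
  case/and3P: ab => /= a0 b0 _.
  by rewrite rank_col_row // mul_col_row_eq0 (negPf a0) (negPf b0).
rewrite -(@card_fibres _ _ A f); last first.
  move=> [a b]; rewrite inE => /and4P[/= a0 b0 /eqP ba /eqP bPa].
  pose g (t : F) := (t *: a, t^-1 *: b).
  have g_inj : injective g.
    move=> s t [/eqP]; rewrite -subr_eq0 -scalerBl scalemx_eq0 (negPf a0).
    by rewrite orbF subr_eq0 => /eqP.
  rewrite -(cardsC1 (0 : F)) -(card_imset _ g_inj); apply: eq_card => z.
  rewrite !inE; apply/andP/imsetP => [[_ /eqP /outer_eq [] // t t0 [z1 z2]]|[t]].
    by exists t; rewrite ?inE // /g -z1 -z2; case: z {z1 z2}.
  rewrite !inE => t0 ->; rewrite /f /g /= !scalemx_eq0 invr_eq0 (negPf t0) a0 b0 /=.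
  rewrite -scalemxAl [(t *: a)^T]linearZ /= -!scalemxAl -!scalemxAr ba.
  by rewrite [(t *: _)^T]linearZ /= -scalemxAr bPa !scaler0 scalerA mulfV // scale1r !eqxx.
rewrite (card_pairs (fun a => a != 0)
  (fun a b => [&& b != 0, b *m a^T == 0 & b *m (a *m P^T)^T == 0])).
rewrite (eq_bigr (fun a : 'rV_3 => if (a *m P^T <= a)%MS then (q ^ 2).-1 else q.-1)).
  by rewrite (sum_if_const (fun a : 'rV_3 => a != 0)
    (fun a => (a *m P^T <= a)%MS)) card_neq0_rV.
by move=> a a0; rewrite card_orth2 //; case: (_ <= _)%MS.
Qed.

Lemma card_nilpotent_perp P : q = 1 %[mod 3] -> P != 0 -> \tr P = 0 -> Q8 (rho P) = 0 ->
  let m := (q ^ 2 + q + 1)%N in let t := theta q 3 in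
  #|nilpotent_perp P| = (q.-1 * (if nilpotent P then m * t - t + 1 else m * t))%N.
Proof.
move=> hF P0 trP qP m t.
have q1 : (0 < q.-1)%N by have := card_finNzRing_gt1 F; case: q => [|[]].
pose R x N := (N \in flag_plane x) && ((N != 0) && (\tr (P *m N) == 0)).
(* Count pairs of a flag and a nonzero matrix of its plane orthogonal to P, by flags and then by
   matrices. *)
have E := @double_count _ _ (@flag F) R (fun N => N \in nilpotent_perp P).
rewrite (eq_bigr (fun x => if inv_flag P x then (q ^ 3).-1 else (q ^ 2).-1)) in E;
  last first.
  move=> x fx; rewrite (_ : [set N | R x N] =
    [set N in flag_plane x | \tr (P *m N) == 0] :\ 0).
    have := card_flag_plane_perp P fx; rewrite (cardsD1 0) inE flag_plane0.
    rewrite mulmx0 mxtrace0 eqxx /= => H; apply: succn_inj; rewrite -add1n H.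
    by case: ifP => _; rewrite prednK // expn_gt0; have := card_finNzRing_gt1 F; case: q.
  by apply/setP => N; rewrite !inE /R andbCA.
rewrite [in RHS](eq_bigr (fun N => if \rank N == 1%N then q.-1 ^ 2 * (2 * q + 1)
    else q.-1 ^ 2)%N) in E; last first.
  move=> N; rewrite inE => /and3P[N0 nN trN]; rewrite -card_flags_nilpotent //.
  by apply: eq_card => x; rewrite !inE /R N0 trN !andbT.
have {}E := E _.
have := sum_if_const (@flag F) (inv_flag P) (q ^ 3).-1 (q ^ 2).-1.
rewrite {}E; last by move=> x N fx /and3P[Nx N0 trN]; rewrite inE N0 trN andbT /=;
  apply/existsP; exists x; rewrite fx.
have := sum_if_const (fun N => N \in nilpotent_perp P) (fun N => \rank N == 1%N)
   (q.-1 ^ 2 * (2 * q + 1))%N (q.-1 ^ 2)%N.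
have -> : [set x | flag x && inv_flag P x] = [set x | inv_flag P x].
  by apply/setP => x; rewrite !inE /inv_flag; case: (flag x).
have := card_inv_flags hF P0 trP qP; have := card_rank1_perp P.
have -> : [set N in nilpotent_perp P] = nilpotent_perp P.
  by apply/setP => N; rewrite inE.
rewrite card_flags; move: (\sum_(i in _) _)%N => Sum.
move: #|nilpotent_perp P| #|[set N in nilpotent_perp P | \rank N == 1%N]| => s s1.
move: #|eigenvectors P| #|[set x | inv_flag P x]| => e i.
(* The truncated subtraction is removed: m t - t is (m - 1) t. *)
have {m t} -> : (if nilpotent P then m * t - t + 1 else m * t)%N
  = ((q ^ 2 + q + (~~ nilpotent P)) * (q ^ 2 + 1) + nilpotent P)%N.
  by rewrite /m /t /theta /=; case: nilpotent; rewrite ?addn0 // mulnDl mul1n addnK.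
rewrite pred_sqr pred_cube; move: q1 (nilpotent P : bool).
case: q => [|k] //= k0 nP H1 H2 H3 H4.
have k2 : (0 < k ^ 2)%N by rewrite expn_gt0 k0.
apply/eqP; rewrite -(eqn_pmul2l k2); apply/eqP.
(* With q = k + 1, these multipliers produce the terms in [s1] and [i] that the double count
   contains. The number [e] then cancels, and the rest is linear in the monomials. *)
have {}H1 := congr1 (muln (2 * k.+1 * k)) H1.
have {}H2 := congr1 (muln (k * k.+1 ^ 2)) H2.
case: nP H2 => /= H2; lia.
Qed.

End NilpotentPerp.

(** * The hexagon and the quadric *)

Section Points.
Import GRing.Theory.
Local Open Scope ring_scope.
Variable F : finFieldType.
Implicit Types (M N P : 'M[F]_3) (a b c d u v : 'rV[F]_3).
Implicit Types x y : 'rV[F]_3 * 'rV[F]_3.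
Local Notation q := #|F|.

(** * Points of PG(8,q) as nonzero matrices up to scalars *)

Definition pt N : 'M[F]_9 := <<rho N>>%MS.

Lemma rho0 : rho (0 : 'M[F]_3) = 0.
Proof. by apply/rowP => i; rewrite !mxE. Qed.

Lemma rho_eq0 N : (rho N == 0) = (N == 0).
Proof. by rewrite -rho0 (inj_eq (can_inj (@rhoK F))). Qed.

Lemma pt_point N : N != 0 -> pt N \in pg_points F 9.
Proof. by move=> N0; rewrite inE genmx_id eqxx mxrank_gen rank_rV rho_eq0 N0. Qed.

Lemma pg_pointP (U : 'M[F]_9) :
  U \in pg_points F 9 -> exists2 N, N != 0 & U = pt N.
Proof.
rewrite inE => /andP[/eqP <- /eqP]; rewrite mxrank_gen => /mxrank1P[a [b [a0 b0 ->]]].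
exists (unrho b); first by rewrite -rho_eq0 unrhoK.
apply/genmxP; rewrite unrhoK; apply/eqmxP/eqmxP; rewrite submxMl.
have [e ea] := exists_dual a0.
by apply/submxP; exists e; rewrite mulmxA ea mul1mx.
Qed.

Lemma pt_sub N m (U : 'M[F]_(m, 9)) : (pt N <= U)%MS = (rho N <= U)%MS.
Proof. by rewrite /pt genmxE. Qed.

Lemma sub_pt N (v : 'rV[F]_9) : reflect (exists t, v = rho (t *: N)) (v <= pt N)%MS.
Proof.
rewrite /pt genmxE; apply: (iffP sub_rVP) => -[t ->]; exists t; by rewrite rhoZ.
Qed.

Lemma pt_eq M N : M != 0 -> pt M = pt N -> exists2 t, t != 0 & M = t *: N.
Proof.
move=> M0 E; have /sub_pt[t /(can_inj (@rhoK F)) Mt] : (rho M <= pt N)%MS.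
  by rewrite -E /pt genmxE.
exists t => //; by apply: contraNneq M0 => t0; rewrite Mt t0 scale0r.
Qed.

Lemma ptZ t N : t != 0 -> pt (t *: N) = pt N.
Proof. by move=> t0; apply/genmxP/eqmxP; rewrite rhoZ; apply: eqmx_scale. Qed.

Lemma card_pt (A : {set 'M[F]_9}) : A \subset pg_points F 9 ->
  #|[set N | (N != 0) && (pt N \in A)]| = (q.-1 * #|A|)%N.
Proof.
move=> /subsetP Apt; set B := [set N | _].
have -> : A = pt @: B.
  apply/setP => U; apply/idP/imsetP => [AU|[N]]; last by rewrite inE => /andP[_ ?] ->.
  by have [N N0 UN] := pg_pointP (Apt U AU); exists N; rewrite // inE N0 -UN.
apply: card_fibres => N; rewrite inE => /andP[N0 AN].
have g_inj : injective (fun t => t *: N).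
  move=> s t /eqP; rewrite -subr_eq0 -scalerBl scalemx_eq0 (negPf N0).
  by rewrite orbF subr_eq0 => /eqP.
rewrite -(cardsC1 (0 : F)) -(card_imset _ g_inj); apply: eq_card => M.
rewrite !inE; apply/andP/imsetP => [[/andP[M0 _] /eqP /(pt_eq M0)[t t0 ->]]|[t]].
  by exists t; rewrite ?inE.
by rewrite !inE => t0 ->; rewrite scalemx_eq0 (negPf t0) N0 ptZ // AN eqxx.
Qed.

(** * Points, lines and planes of the hexagon *)

Lemma rank_oneE a b : rank_one a b = a^T *m b.
Proof. by apply/matrixP => i j; rewrite !mxE big_ord1 !mxE. Qed.

Lemma hexagon_pointP (U : 'M[F]_9) :
  reflect (exists a b, flag (a, b) /\ U = pt (a^T *m b)) (U \in hexagon_points F).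
Proof.
rewrite inE; apply: (iffP andP) => [[UPi /imset2P[a b]]|[a [b [/and3P[/= a0 b0 ab] ->]]]].
  rewrite !inE => a0 b0; rewrite rank_oneE => UE; exists a, b; split=> //.
  move: UPi; rewrite inE UE => /andP[_]; rewrite -/(pt _) pt_sub rho_sub_Pi.
  by rewrite tr_outer -mx11_eq0 mul_tr_eq0C /flag /= a0 b0.
split; last by apply/imset2P; exists a b; rewrite ?inE // rank_oneE.
rewrite inE pt_sub rho_sub_Pi tr_outer -mx11_eq0 mul_tr_eq0C ab andbT.
by rewrite pt_point // mul_col_row_eq0 negb_or a0.
Qed.

Lemma hexagon_lineI M N : \rank (col_mx (rho M) (rho N)) = 2%N ->
  (forall s t, s *: M + t *: N != 0 -> pt (s *: M + t *: N) \in hexagon_points F) ->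
  <<col_mx (rho M) (rho N)>>%MS \in hexagon_lines F.
Proof.
move=> r2 H; rewrite inE; apply/andP; split.
  by rewrite inE genmx_id mxrank_gen r2 !eqxx.
apply/subsetP => U; rewrite inE => /andP[/pg_pointP[K K0 ->]].
rewrite pt_sub genmxE => /submxP[D]; rewrite -[D]hsubmxK mul_row_col.
rewrite [lsubmx D]mx11_scalar [rsubmx D]mx11_scalar !mul_scalar_mx -!rhoZ -rhoD.
by move/(can_inj (@rhoK F)) => KE; rewrite KE in K0 *; apply: H.
Qed.

Lemma flag_planeD x M N :
  M \in flag_plane x -> N \in flag_plane x -> M + N \in flag_plane x.
Proof.
case: x => a b /flag_planeP[c [d [ca db ->]]] /flag_planeP[c' [d' [ca' db' ->]]].
apply/flag_planeP; exists (c + c'), (d + d'); split.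
- by rewrite mulmxDl ca ca' addr0.
- by rewrite mulmxDl db db' addr0.
- by rewrite [(d + d')^T]linearD /= mulmxDl mulmxDr addrACA.
Qed.

(** All matrices on [L] have rank at most 1. Applied to the sum of [a^T *m b] and [N], this forces
    the two to share their column or their row factor up to scalars. *)
Lemma sub_hexagon_line a b (L : 'M[F]_9) N : flag (a, b) ->
  L \in hexagon_lines F -> (pt (a^T *m b) <= L)%MS -> (rho N <= L)%MS ->
  N \in flag_plane (a, b).
Proof.
move=> /and3P[/= a0 b0 /eqP ab]; rewrite inE => /andP[_ /subsetP Lhex] xL NL.
have rank1 M : (rho M <= L)%MS -> M = 0 \/ exists u v, flag (u, v) /\ M = u^T *m v.
  move=> ML; have [|M0] := eqVneq M 0; [by left | right].
  have /hexagon_pointP[u [v [uv]]] : pt M \in hexagon_points F.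
    by apply: Lhex; rewrite inE pt_point // pt_sub.
  case/(pt_eq M0) => t t0 ME; exists (t *: u), v; split; last first.
    by rewrite ME [(t *: u)^T]linearZ /= -scalemxAl.
  case/and3P: uv => /= u0 v0 /eqP uv.
  by rewrite /flag /= scalemx_eq0 (negPf t0) u0 v0 -scalemxAl uv scaler0 eqxx.
have [->|[u [v [/and3P[/= u0 v0 /eqP uv] NE]]]] := rank1 N NL; first exact: flag_plane0.
have rsum : (\rank (a^T *m b + u^T *m v)%R <= 1)%N.
  have : (rho (a^T *m b + u^T *m v) <= L)%MS by rewrite rhoD addmx_sub -?NE // -pt_sub.
  case/rank1 => [->|[c [d [/and3P[/= c0 d0 _] ->]]]]; first by rewrite mxrank0.
  by rewrite rank_col_row.
have /eqP vu : v *m u^T == 0 by rewrite mul_tr_eq0C uv.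
rewrite NE; apply/flag_planeP; case/orP: (rank_outer_sum a0 b0 rsum).
  case/(sub_row_neq0 u0) => t t0 ->; exists (t^-1 *: v), 0.
  rewrite trmx0 !mul0mx addr0 [(t *: u)^T]linearZ /= -!scalemxAl -!scalemxAr vu !scaler0.
  by rewrite scalerA mulfV // scale1r.
case/(sub_row_neq0 v0) => t t0 ->; exists 0, (t^-1 *: u).
rewrite !mul0mx mulmx0 add0r [(t *: v)^T]linearZ /= [(t^-1 *: u)^T]linearZ /=.
by rewrite -!scalemxAl -!scalemxAr uv !scaler0 scalerA mulVf // scale1r.
Qed.

Lemma outer_scaleDr (s t : F) a b b' :
  s *: (a^T *m b) + t *: (a^T *m b') = a^T *m (s *: b + t *: b').
Proof. by rewrite mulmxDr -!scalemxAr. Qed.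

Lemma outer_scaleDl (s t : F) a a' b :
  s *: (a^T *m b) + t *: (a'^T *m b) = (s *: a + t *: a')^T *m b.
Proof.
by rewrite [(_ + _)^T]linearD /= ![(_ *: _)^T]linearZ /= mulmxDl -!scalemxAl.
Qed.

Lemma rank_rho_pair M N : M != 0 ->
  (forall t, N != t *: M) -> \rank (col_mx (rho M) (rho N)) = 2%N.
Proof.
move=> M0 NM; rewrite -addsmxE mxrank_add_row rank_rV rho_eq0 M0.
case: (boolP (rho N <= rho M)%MS) => // /sub_rVP[t]; rewrite -rhoZ.
by move/(can_inj (@rhoK F)) => NE; move: (NM t); rewrite NE eqxx.
Qed.

(** For independent [b] and [c], the matrices with column factor [a] and row factor in the span of
    [b] and [c] form a hexagon line through the point. *)
Lemma hexagon_plane_outer_l a b c : flag (a, b) -> c *m a^T = 0 -> ~~ (c <= b)%MS ->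
  (rho (a^T *m b) <= hexagon_plane (pt (a^T *m b)))%MS /\
  (rho (a^T *m c) <= hexagon_plane (pt (a^T *m b)))%MS.
Proof.
move=> /and3P[/= a0 b0 /eqP ab] ca cb; have [e ea] := exists_dual a0.
have /eqP ba : b *m a^T == 0 by rewrite mul_tr_eq0C ab.
pose L := <<col_mx (rho (a^T *m b)) (rho (a^T *m c))>>%MS.
have rL : L \in hexagon_lines F.
  apply: hexagon_lineI.
    apply: rank_rho_pair => [|t]; first by rewrite mul_col_row_eq0 negb_or a0.
    apply: contraNneq cb => E; apply/sub_rVP; exists t.
    by rewrite -[c]mul1mx -ea -mulmxA E -scalemxAr mulmxA ea mul1mx.
  move=> s t; rewrite outer_scaleDr mul_col_row_eq0 negb_or a0 /= => bc0.
  apply/hexagon_pointP; exists a, (s *: b + t *: c); split=> //.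
  rewrite /flag /= a0 bc0 mul_tr_eq0C mulmxDl -!scalemxAl ba ca !scaler0 addr0 //=.
have L1 : (rho (a^T *m b) <= L)%MS by rewrite genmxE -addsmxE addsmxSl.
have L2 : (rho (a^T *m c) <= L)%MS by rewrite genmxE -addsmxE addsmxSr.
by split; [apply: (submx_trans L1)|apply: (submx_trans L2)];
  apply: (sumsmx_sup L); rewrite ?rL ?pt_sub.
Qed.

Lemma hexagon_plane_outer_r a b d : flag (a, b) -> d *m b^T = 0 -> ~~ (d <= a)%MS ->
  (rho (d^T *m b) <= hexagon_plane (pt (a^T *m b)))%MS.
Proof.
move=> /and3P[/= a0 b0 /eqP ab] db da; have [e eb] := exists_dual b0.
pose L := <<col_mx (rho (a^T *m b)) (rho (d^T *m b))>>%MS.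
have rL : L \in hexagon_lines F.
  apply: hexagon_lineI.
    apply: rank_rho_pair => [|t]; first by rewrite mul_col_row_eq0 negb_or a0.
    apply: contraNneq da => E; apply/sub_rVP; exists t; apply: trmx_inj.
    apply/eqP; rewrite -subr_eq0 -(mul_row_eq0 _ b0) mulmxBl E.
    by rewrite [(t *: a)^T]linearZ /= -scalemxAl subrr.
  move=> s t; rewrite outer_scaleDl mul_col_row_eq0 negb_or => /andP[ad0 _].
  apply/hexagon_pointP; exists (s *: a + t *: d), b; split=> //.
  by rewrite /flag /= ad0 b0 mulmxDl -!scalemxAl ab db !scaler0 addr0 eqxx.
have L1 : (rho (a^T *m b) <= L)%MS by rewrite genmxE -addsmxE addsmxSl.
have L2 : (rho (d^T *m b) <= L)%MS by rewrite genmxE -addsmxE addsmxSr.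
by apply: (submx_trans L2); apply: (sumsmx_sup L); rewrite ?rL ?pt_sub.
Qed.

Lemma exists_orth_indep a b : a != 0 -> b != 0 ->
  exists2 c : 'rV_3, c *m a^T = 0 & ~~ (c <= b)%MS.
Proof.
move=> a0 b0; have : ~~ (kermx a^T <= b)%MS.
  apply/negP => /mxrankS; rewrite mxrank_ker mxrank_tr !rank_rV a0 b0 //.
case/row_subPn => i ib; exists (row i (kermx a^T)) => //.
by rewrite -row_mul mulmx_ker row0.
Qed.

Lemma hexagon_planeE a b N : flag (a, b) ->
  (rho N <= hexagon_plane (pt (a^T *m b)))%MS = (N \in flag_plane (a, b)).
Proof.
move=> fab; case/and3P: (fab) => /= a0 b0 /eqP ab.
apply/idP/flag_planeP => [|[c [d [ca db ->]]]].
  case/sub_sumsmxP => u NE; apply/flag_planeP; rewrite -[N]rhoK NE.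
  elim/big_ind: _ => [|v w vx wx|L /andP[Lhex xL]].
  - by rewrite -rho0 rhoK flag_plane0.
  - rewrite -[v]unrhoK -[w]unrhoK -rhoD rhoK; exact: flag_planeD.
  - by apply: (sub_hexagon_line fab Lhex xL); rewrite unrhoK submxMl.
(* This provides one hexagon line through the point, so [a^T *m b] lies in the plane; it settles the
   degenerate cases where [c] is a multiple of [b] or [d] of [a]. *)
have [c' ca' cb'] := exists_orth_indep a0 b0.
have [xpl _] := hexagon_plane_outer_l fab ca' cb'.
rewrite rhoD addmx_sub //.
  case: (boolP (c <= b)%MS) => [/sub_rVP[t ->]|cb].
    by rewrite -scalemxAr rhoZ scalemx_sub.
  by case: (hexagon_plane_outer_l fab ca cb).
case: (boolP (d <= a)%MS) => [/sub_rVP[t ->]|da].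
  by rewrite [(t *: a)^T]linearZ /= -scalemxAl rhoZ scalemx_sub.
exact: hexagon_plane_outer_r.
Qed.

Lemma pt_ovoid N : N != 0 ->
  (pt N \in (\bigcup_(x in hexagon_points F) points_on (hexagon_plane x))%SET)
  = nilpotent N.
Proof.
move=> N0; apply/bigcupP/nilpotentP.
  case=> [U /hexagon_pointP[a [b [fab ->]]]].
  by rewrite inE pt_sub hexagon_planeE // => /andP[_ Nab]; exists a, b.
case=> a [b [fab Nab]]; exists (pt (a^T *m b)); first by apply/hexagon_pointP; exists a, b.
by rewrite inE pt_point // pt_sub hexagon_planeE.
Qed.

(** * Membership in the quadric and in its polar hyperplanes *)

Lemma Q8_rhoZ (t : F) N : Q8 (rho (t *: N)) = t ^+ 2 * Q8 (rho N).
Proof. by rewrite !Q8_rho !mxE; ring. Qed.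

Lemma pt_hq_points (hF : q = 1 %[mod 3]) N : N != 0 ->
  (pt N \in hq_points (Qplus7 hF)) = (\tr N == 0) && (Q8 (rho N) == 0).
Proof.
move=> N0; rewrite !inE -/(pg_points F 9) -[_ && (\rank _ == _)]/(_ && _).
have := pt_point N0; rewrite inE => -> /=; rewrite pt_sub rho_sub_Pi; congr (_ && _).
apply/forallP/eqP => [/(_ (rho N))|qN v].
  by rewrite /pt genmxE submx_refl => /eqP.
by apply/implyP => /sub_pt[t ->]; rewrite Q8_rhoZ qN mulr0.
Qed.

Lemma pt_hq_perp (hF : q = 1 %[mod 3]) M N : M != 0 -> N != 0 -> \tr M = 0 ->
  (pt N \in hq_perp (Qplus7 hF) (pt M))
  = (pt N \in hq_points (Qplus7 hF)) && (\tr (M *m N) == 0).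
Proof.
move=> M0 N0 trM; rewrite inE; congr (_ && _).
apply/forallP/eqP => [/(_ (rho M))/forallP/(_ (rho N))|tr0 u].
  by rewrite /pt !genmxE !submx_refl polar_Q8_rho trM mul0r subr0 => /eqP.
apply/forallP => v; apply/implyP => /andP[/sub_pt[s ->] /sub_pt[t ->]].
rewrite polar_Q8_rho -scalemxAl -scalemxAr !mxtraceZ tr0 trM.
by rewrite !mulr0 mul0r subr0.
Qed.

Lemma Q8_outer_sum a b c d :
  Q8 (rho (a^T *m c + d^T *m b))
  = (a *m b^T) 0 0 * (c *m d^T) 0 0 - (c *m a^T) 0 0 * (d *m b^T) 0 0.
Proof. by rewrite Q8_rho !(mxE, big_ord1, big_inord3); ring. Qed.

Lemma nilpotent_quadric N : nilpotent N -> \tr N = 0 /\ Q8 (rho N) = 0.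
Proof.
move=> /nilpotentP[a [b [/and3P[/= _ _ /eqP ab] Nab]]].
split; first exact: flag_plane_tr Nab.
case/flag_planeP: Nab => c [d [ca db ->]].
by rewrite Q8_outer_sum ab ca !mxE !mul0r subrr.
Qed.

End Points.

Theorem theorem3p3 (F : finFieldType) (hF : #|F| = 1 %[mod 3]) :
  m_ovoid (Qplus7 hF) (#|F| ^ 2 + #|F| + 1)%N
    (\bigcup_(x in hexagon_points F) points_on (hexagon_plane x))%SET.
Proof.
set O := (\bigcup_(x in _) _)%SET.
have O_pt : O \subset pg_points F 9.
  by apply/bigcupsP => U _; apply/subsetP => R; rewrite inE => /andP[].
split; first by rewrite addn1.
  apply/subsetP => R RO; have [N N0 RE] := pg_pointP (subsetP O_pt _ RO).
  move: RO; rewrite RE pt_ovoid // pt_hq_points // => /nilpotent_quadric[-> ->].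
  by rewrite eqxx.
move=> R Rhq; have [M M0 RE] : exists2 M, M != 0%R & R = pt M.
  by apply: pg_pointP; move: Rhq; rewrite !inE => /andP[/andP[]].
move: Rhq; rewrite {}RE pt_hq_points // pt_ovoid // => /andP[/eqP trM /eqP qM].
have q1 : (0 < #|F|.-1)%N by have := card_finNzRing_gt1 F; case: #|F| => [|[]].
(* Multiplying by q - 1 turns the count of points into the count of nonzero matrices. *)
apply/eqP; rewrite -(eqn_pmul2l q1) -(card_nilpotent_perp hF M0 trM qM) -card_pt.
  apply/eqP/eq_card => N; rewrite [LHS]inE [RHS]inE.
  case: (eqVneq N 0%R) => //= N0.
  rewrite in_setI pt_hq_perp // pt_hq_points // pt_ovoid // andbC.
  by case: (boolP (nilpotent N)) => //= /nilpotent_quadric[-> ->]; rewrite eqxx.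
by apply: subset_trans O_pt; apply: subsetIr.
Qed.
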